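(* Let $\phi:\Sigma^n\to I\times_f M^n$ be an isometric immersion of a gradient Einstein-type structure $(\Sigma^n,g,h,u,\mu,\lambda)$ with potential function $h=\pi_I\circ\phi$ and with smooth map $u=\phi$ (so the target of $u$ is $I\times_f M^n$), where the fiber $M^n$ has sectional curvature $k_M\le\inf_I(f'^2-ff'')$. Then the following statements hold. (a) There is no such isometric immersion of a gradient Einstein-type structure into $I\times_f M^n$ with $\lambda\ge-(n-1)\frac{f''(h)}{f(h)}$. (b) If $\lambda\ge-(n-1)\frac{f''(h)}{f(h)}-\frac{\alpha}{n}|\nabla u|^2$, then $\Sigma^n$ is Einstein harmonic and totally geodesic in $I\times_f M^n$. Furthermore, the smooth map $u$ satisfies $$\alpha|\nabla u|^2=n\left(-(n-1)\frac{f''(h)}{f(h)}-\lambda\right).$$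
   Context: A gradient Einstein-type structure $(\Sigma^n,g,h,u,\mu,\lambda)$ consists of a connected, complete (possibly compact) Riemannian manifold $(\Sigma^n,g)$, a real number $\alpha>0$, a smooth map $u:(\Sigma^n,g)\to(N^p,g')$ into a Riemannian manifold, with tension field $\tau_g u=\mathrm{trace}\,\nabla(du)$, and smooth functions $h,\mu,\lambda$ on $\Sigma$ such that $Ric_g-\alpha u^*g'+\mathrm{Hess}\,h-\mu\,dh\otimes dh=\lambda g$ and $\tau_g u=du(\nabla h)$. It is called Einstein harmonic (trivial) if $h$ is constant. Here $|\nabla u|^2=|du|^2$ is the trace of $u^*g'$ with respect to $g$. $I\times_f M^n$ is $I\times M^n$ with metric $\langle\,,\rangle=\pi_I^*(dt^2)+f^2(\pi_I)\pi_M^*(g_M)$, where $I\subset\mathbb{R}$ is an open interval, $f:I\to(0,\infty)$ is smooth, and $M^n$ is a connected oriented Riemannian manifold. Totally geodesic means that the shape operator $A$ vanishes. *)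

(* Defs.v *)
From HB Require Import structures.
From mathcomp Require Import all_boot all_order all_algebra.
From mathcomp Require Import all_classical all_reals all_analysis.

Set Implicit Arguments.
Unset Strict Implicit.
Unset Printing Implicit Defensive.

Import Order.TTheory GRing.Theory Num.Theory.
Import numFieldNormedType.Exports.

Local Open Scope ring_scope.
Local Open Scope classical_set_scope.

(* Conventions.  Tangent vectors are represented, in a chart, by the row vector
   of their components, so that the differential of a map acts by
   right multiplication with its Jacobian J i a = d_i F^a.  Tensor fields are
   given by their components in every chart of the atlas, and tensor equations
   are required in every chart around every point. *)

Section Smooth.
Variables (R : realType) (V : normedModType R).

Fixpoint Ck (k : nat) (U : set V) (f : V -> R) : Prop :=
  match k with
  | 0 => forall x, U x -> {for x, continuous f}
  | k'.+1 => (forall x, U x -> differentiable f x) /\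
             (forall v : V, Ck k' U (fun x => 'D_v f x))
  end.

(* Only meant for an open U *)
Definition smooth_on (U : set V) (f : V -> R) : Prop := forall k, Ck k U f.

End Smooth.

Definition partial (R : realType) (n : nat) (i : 'I_n) (f : 'rV[R]_n -> R)
  (x : 'rV[R]_n) : R := 'D_(delta_mx 0 i) f x.

Definition jac (R : realType) (n m : nat) (F : 'rV[R]_n -> 'rV[R]_m)
  (x : 'rV[R]_n) : 'M[R]_(n, m) :=
  \matrix_(i, a) partial i (fun y => F y 0 a) x.

(* The manifold is the union of the chart domains, which are open subsets of the
   topological space T.  This lets I x M live in R * T for an open interval I.
   [param c] is the inverse of [coords c], with irrelevant values outside the
   range of the chart. *)
Record atlas (R : realType) (n : nat) (T : topologicalType) := Atlas {
  chart : Type;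
  dom : chart -> set T;
  coords : chart -> T -> 'rV[R]_n;
  param : chart -> 'rV[R]_n -> T
}.

Section Manifold.
Variables (R : realType) (n : nat) (T : topologicalType) (A : atlas R n T).
Implicit Types c d : chart A.

Definition carrier : set T := [set p | exists c, dom c p].

Definition range_of c : set 'rV[R]_n := coords c @` dom c.

Definition transition c d : 'rV[R]_n -> 'rV[R]_n := coords d \o param c.

Definition transition_dom c d : set 'rV[R]_n := coords c @` (dom c `&` dom d).

Definition is_manifold : Prop :=
  [/\ hausdorff_space T, @second_countable T,
    (forall c, [/\ open (dom c), open (range_of c),
       (forall p, dom c p -> param c (coords c p) = p),
       (forall p, dom c p -> {for p, continuous (coords c)}) &
       (forall x, range_of c x -> {for x, continuous (param c)})]) &
    (forall c d (a : 'I_n),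
       smooth_on (transition_dom c d) (fun x => transition c d x 0 a))].

(* The empty manifold is excluded *)
Definition connected_manifold : Prop :=
  carrier !=set0 /\ connected carrier.

(* o c p tells whether the basis of T_p given by the chart c is positive *)
Definition is_orientation (o : chart A -> T -> bool) : Prop :=
  (forall c p, dom c p -> \forall q \near p, o c q = o c p) /\
  (forall c d p, dom c p -> dom d p ->
     (o d p == o c p) = (0 < \det (jac (transition c d) (coords c p)))).

Definition smooth_fun (h : T -> R) : Prop :=
  forall c, smooth_on (range_of c) (h \o param c).

Definition metric := chart A -> 'rV[R]_n -> 'M[R]_n.

Definition is_riemannian (g : metric) : Prop :=
  [/\ is_manifold,
    (forall c i j, smooth_on (range_of c) (fun x => g c x i j)),
    (forall c x, range_of c x -> (g c x)^T = g c x),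
    (forall c x (v : 'rV[R]_n), range_of c x -> v != 0 ->
       0 < (v *m g c x *m v^T) 0 0) &
    (forall c d x, transition_dom c d x ->
       let J := jac (transition c d) x in
       g c x = J *m g d (transition c d x) *m J^T)].

End Manifold.

Section Curvature.
Variables (R : realType) (n : nat) (T : topologicalType) (A : atlas R n T).
Variable g : metric A.
Implicit Types (c : chart A) (x : 'rV[R]_n).

(* christoffel c x k i j is Gamma^k_{ij} *)
Definition christoffel c x (k i j : 'I_n) : R :=
  2^-1 * \sum_(l < n) invmx (g c x) k l *
    (partial i (fun y => g c y j l) x + partial j (fun y => g c y i l) x
     - partial l (fun y => g c y i j) x).

(* riemann c x i j k l is the l-th component of R(d_i, d_j) d_k, where
   R(X, Y) = [nabla_X, nabla_Y] - nabla_[X, Y] *)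
Definition riemann c x (i j k l : 'I_n) : R :=
  partial i (fun y => christoffel c y l j k) x
  - partial j (fun y => christoffel c y l i k) x
  + \sum_(m < n) (christoffel c x l i m * christoffel c x m j k
                  - christoffel c x l j m * christoffel c x m i k).

(* Ric(Y, Z) = trace (X |-> R(X, Y) Z) *)
Definition ricci c x : 'M[R]_n :=
  \matrix_(j, k) \sum_(i < n) riemann c x i j k i.

Definition inner c x (v w : 'rV[R]_n) : R := (v *m g c x *m w^T) 0 0.

(* R(v, w) w *)
Definition riemann_vww c x (v w : 'rV[R]_n) : 'rV[R]_n :=
  \row_l \sum_(i < n) \sum_(j < n) \sum_(k < n)
    v 0 i * w 0 j * w 0 k * riemann c x i j k l.

Definition sectional c x (v w : 'rV[R]_n) : R :=
  inner c x (riemann_vww c x v w) v /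
  (inner c x v v * inner c x w w - inner c x v w ^+ 2).

(* K(v, w) <= b for all linearly independent tangent vectors v, w *)
Definition sectional_le (b : \bar R) : Prop :=
  forall c p (v w : 'rV[R]_n), dom c p -> \rank (col_mx v w) = 2%N ->
    ((sectional c (coords c p) v w)%:E <= b)%E.

Definition dfun (h : T -> R) c x : 'rV[R]_n :=
  \row_i partial i (h \o param c) x.

Definition gradient (h : T -> R) c x : 'rV[R]_n :=
  dfun h c x *m invmx (g c x).

Definition hess (h : T -> R) c x : 'M[R]_n :=
  \matrix_(i, j) (partial i (partial j (h \o param c)) x
    - \sum_(k < n) christoffel c x k i j * partial k (h \o param c) x).

(* A smooth curve gamma with nabla_gamma' gamma' = 0, defined on all of R *)
Definition is_geodesic (gamma : R -> T) : Prop :=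
  [/\ (forall t, carrier A (gamma t)), continuous gamma &
    forall c,
      let U := gamma @^-1` dom c in
      let x k s := coords c (gamma s) 0 k in
      (forall k, smooth_on U (x k)) /\
      (forall k t, U t ->
        (x k)^`(2)%classic t + \sum_(i < n) \sum_(j < n)
          christoffel c (coords c (gamma t)) k i j
            * (x i)^`()%classic t * (x j)^`()%classic t = 0)].

(* Geodesic completeness: exp_p is defined on all of T_p, for every p *)
Definition complete_manifold : Prop :=
  forall c p (v : 'rV[R]_n), dom c p ->
    exists gamma, [/\ is_geodesic gamma, gamma 0 = p &
      forall k, (fun s => coords c (gamma s) 0 k)^`()%classic 0 = v 0 k].

End Curvature.

Section Maps.
Variables (R : realType) (n m : nat) (T T' : topologicalType).
Variables (A : atlas R n T) (B : atlas R m T').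
Variables (g : metric A) (g' : metric B).
Variable u : T -> T'.
Implicit Types (c : chart A) (d : chart B) (x : 'rV[R]_n).

Definition local_map c d : 'rV[R]_n -> 'rV[R]_m := coords d \o u \o param c.

Definition local_dom c d : set 'rV[R]_n :=
  coords c @` (dom c `&` u @^-1` dom d).

Definition smooth_map : Prop :=
  [/\ (forall p, carrier A p -> carrier B (u p)),
    (forall p, carrier A p -> {for p, continuous u}) &
    (forall c d a, smooth_on (local_dom c d) (fun x => local_map c d x 0 a))].

Definition tangent_map c d x : 'M[R]_(n, m) := jac (local_map c d) x.

Definition pullback c d x : 'M[R]_n :=
  tangent_map c d x *m g' d (local_map c d x) *m (tangent_map c d x)^T.

(* |du|^2, the trace of u^* g' with respect to g *)
Definition energy c d x : R := \tr (invmx (g c x) *m pullback c d x).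

(* a-th component of (nabla du)(d_i, d_j), nabla being induced by the
   Levi-Civita connections of g and g' *)
Definition nabla_diff c d x (i j : 'I_n) (a : 'I_m) : R :=
  partial i (partial j (fun y => local_map c d y 0 a)) x
  - \sum_(k < n) christoffel g c x k i j * tangent_map c d x k a
  + \sum_(b < m) \sum_(e < m) christoffel g' d (local_map c d x) a b e
      * tangent_map c d x i b * tangent_map c d x j e.

Definition tension c d x : 'rV[R]_m :=
  \row_a \sum_(i < n) \sum_(j < n) invmx (g c x) i j * nabla_diff c d x i j a.

Definition isometric_immersion : Prop :=
  smooth_map /\
  forall c d p, dom c p -> dom d (u p) ->
    row_free (tangent_map c d (coords c p)) /\
    pullback c d (coords c p) = g c (coords c p).

(* nu is a smooth unit normal field along u on the coordinate open set U *)
Definition unit_normal c d (U : set 'rV[R]_n)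
    (nu : 'rV[R]_n -> 'rV[R]_m) : Prop :=
  (forall a, smooth_on U (fun x => nu x 0 a)) /\
  (forall x, U x ->
     let G := g' d (local_map c d x) in
     tangent_map c d x *m G *m (nu x)^T = 0 /\ (nu x *m G *m (nu x)^T) 0 0 = 1).

(* Row i holds the components of the covariant derivative of nu along d_i *)
Definition nabla_normal c d (nu : 'rV[R]_n -> 'rV[R]_m) x : 'M[R]_(n, m) :=
  \matrix_(i, a) (partial i (fun y => nu y 0 a) x
    + \sum_(b < m) \sum_(e < m) christoffel g' d (local_map c d x) a b e
        * tangent_map c d x i b * nu x 0 e).

(* A X = - (nabla_X nu)^T: row i holds the components in the chart c of A d_i,
   obtained from the products <nabla_i nu, du d_k> by raising the index k *)
Definition shape_operator c d (nu : 'rV[R]_n -> 'rV[R]_m) x : 'M[R]_n :=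
  - (nabla_normal c d nu x *m g' d (local_map c d x) *m (tangent_map c d x)^T
     *m invmx (g c x)).

(* For hypersurfaces (m = n + 1); no global choice of the unit normal is needed
   since A vanishes for one local unit normal iff it does for the opposite one *)
Definition totally_geodesic : Prop :=
  forall c d (U : set 'rV[R]_n) nu x,
    open U -> U `<=` local_dom c d -> unit_normal c d U nu -> U x ->
    shape_operator c d nu x = 0.

Definition gradient_einstein_type (alpha : R) (h mu lam : T -> R) : Prop :=
  [/\ is_riemannian g, connected_manifold A, complete_manifold g,
    0 < alpha /\ smooth_map &
    [/\ smooth_fun A h, smooth_fun A mu, smooth_fun A lam &
      forall c d p, dom c p -> dom d (u p) -> let x := coords c p in
        ricci g c x - alpha *: pullback c d x + hess g h c x
          - mu p *: ((dfun h c x)^T *m dfun h c x) = lam p *: g c x /\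
        tension c d x = gradient g h c x *m tangent_map c d x]].

End Maps.

Definition einstein_harmonic (R : realType) (n : nat) (T : topologicalType)
  (A : atlas R n T) (h : T -> R) : Prop :=
  exists k : R, forall p, carrier A p -> h p = k.

Section Warped.
Variables (R : realType) (n : nat) (T : topologicalType).
Variables (I : set R) (f : R -> R) (M : atlas R n T) (gM : metric M).

(* I x M as an open subset of R * T, with the charts id x c; the coordinates of
   (t, q) are the row vector (t | coords c q) *)
Definition warped_atlas : atlas R (1 + n) (R * T)%type :=
  @Atlas R (1 + n) (R * T)%type (chart M)
    (fun c => I `*` dom c)
    (fun c p => row_mx (const_mx p.1) (coords c p.2))
    (fun c x => (lsubmx x 0 0, param c (rsubmx x))).

Definition warped_metric : metric warped_atlas :=
  fun c x => block_mx 1%:M 0 0 (f (lsubmx x 0 0) ^+ 2 *: gM c (rsubmx x)).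

End Warped.

Arguments warped_metric {R n T} I f {M} gM c x.

(* Main.v *)
(* The second fundamental form of an isometric immersion is normal, so the
   tension field of phi is normal, whereas du(grad h) is tangent: both vanish.
   Hence h is constant, phi(Sigma) lies in a slice {t0} x M, and the tension
   field, which is -n f'(t0)/f(t0) d/dt there, forces f'(t0) = 0, so that the
   slice is totally geodesic. The fiber part of phi is then a local homothety
   onto its image, so the curvature bound on M gives
     Ric_g <= -(n-1) f''(t0)/f(t0) g,
   while the structure equation reduces to Ric_g = (lambda + alpha) g. Since
   |du|^2 = n, both statements follow by comparison. *)

Require Import Defs.
From mathcomp Require Import all_boot all_order all_algebra.
From mathcomp Require Import all_classical all_reals all_analysis.
From mathcomp Require Import ring lra.
Import Order.TTheory GRing.Theory Num.Theory.
Import numFieldNormedType.Exports.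
Local Open Scope ring_scope.
Local Open Scope classical_set_scope.
Set Implicit Arguments.
Unset Strict Implicit.
Unset Printing Implicit Defensive.

(** * Directional and partial derivatives *)

(** The curvature bound is used at the level [t0]: since [f'] vanishes there, the infimum of f'^2 -
    f f'' is at most - f(t0) f''(t0). If K is the Jacobian of the fiber part of [phi], then g =
    f(t0)^2 K g_M K^T while Ric_g = K Ric_M K^T. The Ricci tensor does not see the constant factor
    but the metric does, and this turns the constant -(n-1) f f'' on M into -(n-1) f''/f on Sigma.
    Tensors exist only through their components, so that a homothety preserves curvature has to be
    derived: in equal dimensions the Gauss formula says that it preserves the connection, and one
    more differentiation of that identity gives the curvature. Orthonormal frames are avoided as
    well: the passage from sectional to Ricci curvature becomes the nonnegativity of a trace, that
    of a positive definite matrix times a nonnegative form. Comparison yields lambda + alpha <=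
    -(n-1) f''/f. In (a) this contradicts alpha > 0; in (b), where |du|^2 = n, the assumption is the
    reverse inequality. *)

Lemma MVT_closed (R : realType) (f df : R -> R) (a b : R) : a < b ->
  (forall x, x \in `[a, b]%R -> is_derive x 1 f (df x)) ->
  exists2 c, c \in `]a, b[%R & f b - f a = df c * (b - a).
Proof.
move=> ab dE.
have oc s : s \in `]a, b[%R -> s \in `[a, b]%R.
  by rewrite !in_itv/= => /andP[? ?]; rewrite !ltW.
have cE s : s \in `[a, b]%R -> {for s, continuous f}.
  by move=> /dE[df1 _]; exact/differentiable_continuous/derivable1_diffP.
have dE' s : s \in `]a, b[%R -> is_derive s 1 f (df s).
  by move=> h; exact: dE (oc s h).
have fc : {within `[a, b], continuous f}.
  apply/continuous_within_itvP => //; split=> [s /oc/cE//||].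
  - by apply: cvg_at_right_filter; apply: cE; rewrite in_itv/= lexx ltW.
  - by apply: cvg_at_left_filter; apply: cE; rewrite in_itv/= lexx ltW.
exact: MVT ab dE' fc.
Qed.

Lemma dist_split (R : realFieldType) (a b c e : R) :
  `|a - c| < e / 2 -> `|b - c| < e / 2 -> `|a - b| < e.
Proof.
move=> h1 h2; rewrite distrC in h2.
by rewrite (le_lt_trans (ler_distD c _ _))// [e]splitr ltrD.
Qed.

Section Calculus.
Variables (R : realType) (V : normedModType R).
Implicit Types (f g : V -> R) (x v : V).

Lemma smooth_differentiable (U : set V) f x :
  smooth_on U f -> U x -> differentiable f x.
Proof. by move=> /(_ 1%N)[+ _] => /[apply]. Qed.

Lemma smooth_derive (U : set V) f v : smooth_on U f -> smooth_on U ('D_v f).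
Proof. by move=> sf k; have [_] := sf k.+1; apply. Qed.

Lemma derivable_smooth (U : set V) f x v :
  smooth_on U f -> U x -> derivable f x v.
Proof. by move=> sf Ux; exact/diff_derivable/(smooth_differentiable sf). Qed.

Lemma derive_mul f g x v : derivable f x v -> derivable g x v ->
  'D_v (fun y => f y * g y) x = 'D_v f x * g x + f x * 'D_v g x.
Proof.
move=> df dg; rewrite [LHS](deriveM df dg).
by rewrite addrC; congr (_ + _); rewrite [LHS]mulrC.
Qed.

Lemma derive_scale (k : R) f x v : derivable f x v ->
  'D_v (fun y => k * f y) x = k * 'D_v f x.
Proof. exact: deriveZ. Qed.

Lemma derive_sub f g x v : derivable f x v -> derivable g x v ->
  'D_v (fun y => f y - g y) x = 'D_v f x - 'D_v g x.
Proof. exact: deriveB. Qed.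

Lemma derivable_bigsum (J : Type) (r : seq J) (F : J -> V -> R) x v :
  (forall j, derivable (F j) x v) -> derivable (fun y => \sum_(j <- r) F j y) x v.
Proof.
move=> dF; elim: r => [|j r IH].
  by under eq_fun do rewrite big_nil; exact: derivable_cst.
by under eq_fun do rewrite big_cons; exact: (derivableD (dF j)).
Qed.

Lemma derive_bigsum (J : Type) (r : seq J) (F : J -> V -> R) x v :
  (forall j, derivable (F j) x v) ->
  'D_v (fun y => \sum_(j <- r) F j y) x = \sum_(j <- r) 'D_v (F j) x.
Proof.
move=> dF; elim: r => [|j r IH].
  by rewrite big_nil; under eq_fun do rewrite big_nil; exact: derive_cst.
rewrite big_cons -IH; under eq_fun do rewrite big_cons.
by apply: (deriveD (dF j)); exact: derivable_bigsum.
Qed.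

Lemma differentiable_bigsum (J : Type) (r : seq J) (F : J -> V -> R) x :
  (forall j, differentiable (F j) x) ->
  differentiable (fun y => \sum_(j <- r) F j y) x.
Proof.
move=> dF; elim: r => [|j r IH].
  by under eq_fun do rewrite big_nil; exact: differentiable_cst.
by under eq_fun do rewrite big_cons; exact: (differentiableD (dF j)).
Qed.

Lemma differentiable_bigprod (J : Type) (r : seq J) (F : J -> V -> R) x :
  (forall j, differentiable (F j) x) ->
  differentiable (fun y => \prod_(j <- r) F j y) x.
Proof.
move=> dF; elim: r => [|j r IH].
  by under eq_fun do rewrite big_nil; exact: differentiable_cst.
by under eq_fun do rewrite big_cons; exact: (differentiableM (dF j)).
Qed.

(** The first order expansion at [x] depends only on the germ. This is what allows [invmx] to be
    replaced by a formula valid near [x]. *)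
Lemma near_eq_differentiable (W : normedModType R) (f g : V -> W) x :
  (\near x, f x = g x) -> differentiable f x -> differentiable g x.
Proof.
move=> fg df; have [dfc /eqaddoP dfe] := (diff_locallyP _ _).1 df.
have ge : g \o shift x = cst (g x) + 'd f x +o_ 0 id.
  apply/eqaddoP => e e0; have fgx := nbhs_singleton fg.
  have fg' : \forall h \near (0 : V), f (h + x) = g (h + x).
    by rewrite (near_shift x 0) /=; near do rewrite /= sub0r subrK//.
  near=> h.
  have : `|(f \o shift x - (cst (f x) + 'd f x)) h| <= e * `|id h|.
    by near: h; exact: dfe.
  rewrite -![(_ + _ : _ -> _) _]/(_ + _) -![(- _ : _ -> _) _]/(- _) /=.
  by rewrite -fgx (near fg' h).
apply/diff_locallyP; have -> : 'd g x = 'd f x :> (V -> W) by exact: diff_unique.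
by [].
Unshelve. all: by end_near. Qed.

Lemma is_derive_line f (y v : V) (s : R) : derivable f (y + s *: v) v ->
  is_derive s 1 (fun s => f (y + s *: v)) ('D_v f (y + s *: v)).
Proof.
set z := y + s *: v.
have E (h : R) : f (y + (h *: (1:R) + s) *: v) = f (h *: v + z).
  by rewrite /z [h *: _]mulr1 scalerDl addrA addrAC addrC.
move=> df; split.
  move: df; rewrite /derivable /=.
  by under [X in _ -> cvg (X @ _)]eq_fun do rewrite /= E.
by rewrite /derive; under eq_fun do rewrite /= E.
Qed.

Lemma ball_line (x v w : V) r (s s' t : R) :
  t * (`|v| + `|w|) < r -> s \in `[0, t]%R -> s' \in `[0, t]%R ->
  ball x r (x + s *: v + s' *: w).
Proof.
move=> tr; rewrite !in_itv/= => /andP[s0 st] /andP[s'0 s't].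
rewrite -ball_normE /ball_/= -addrA opprD addrA subrr sub0r normrN.
apply: le_lt_trans tr; apply: (le_trans (ler_normD _ _)).
rewrite !normrZ !ger0_norm// mulrDr lerD// ler_wpM2r//.
Qed.

(* The mean value theorem, first along v and then along w. *)
Lemma second_difference f x v w r t : 0 < t -> t * (`|v| + `|w|) < r ->
  (forall y, ball x r y -> differentiable f y) ->
  (forall y, ball x r y -> differentiable ('D_v f) y) ->
  exists2 s, s \in `[0, t]%R & exists2 s', s' \in `[0, t]%R &
  f (x + t *: v + t *: w) - f (x + t *: v) - f (x + t *: w) + f x
   = t ^+ 2 * 'D_w ('D_v f) (x + s *: v + s' *: w).
Proof.
move=> t0 tr df dvf.
have t00 : 0 \in `[0, t]%R by rewrite in_itv/= lexx ltW.
have tt : t \in `[0, t]%R by rewrite in_itv/= lexx ltW.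
have oc s : s \in `]0, t[%R -> s \in `[0, t]%R.
  by rewrite !in_itv/= => /andP[? ?]; rewrite !ltW.
pose ph s := f ((x + t *: w) + s *: v) - f (x + s *: v).
pose dph s := 'D_v f ((x + t *: w) + s *: v) - 'D_v f (x + s *: v).
have dphE s : s \in `[0, t]%R -> is_derive s 1 ph (dph s).
  move=> st.
  have b1 : ball x r (x + t *: w + s *: v) by rewrite addrAC; apply: ball_line tr _ _.
  have b2 : ball x r (x + s *: v).
    by have := ball_line x tr st t00; rewrite scale0r addr0.
  apply: is_deriveB; apply: is_derive_line; apply: diff_derivable; exact: df.
have [s st Es] := MVT_closed t0 dphE.
have dq s' : s' \in `[0, t]%R ->
   is_derive s' 1 (fun s' => 'D_v f (x + s *: v + s' *: w))
      ('D_w ('D_v f) (x + s *: v + s' *: w)).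
  move=> st'; apply: is_derive_line; apply: diff_derivable; apply: dvf.
  by apply: ball_line tr _ _ => //; apply: oc.
have [s' st' Es'] := MVT_closed t0 dq.
exists s; [exact: oc|exists s'; first exact: oc].
move: Es Es'; rewrite /ph /dph /= !scale0r !addr0 subr0 [_ + t *: w + s *: v]addrAC.
rewrite [_ + t *: w + t *: v]addrAC => E1 E2.
by rewrite expr2 mulrC mulrA -E2 -E1; ring.
Qed.

(** Schwarz's theorem: the second difference is symmetric in [v] and [w], so the two mixed
    derivatives take a common value at two points near [x]; by continuity each is within e/2 of its
    value at [x]. *)
Lemma derive_swap (U : set V) f x v w : open U -> smooth_on U f -> U x ->
  'D_v ('D_w f) x = 'D_w ('D_v f) x.
Proof.
move=> oU sf Ux; apply/eqP; rewrite -subr_eq0 -normr_le0.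
apply/ler_addgt0Pl => e e0; rewrite addr0.
have c1 := differentiable_continuous
  (smooth_differentiable (smooth_derive v (smooth_derive w sf)) Ux).
have c2 := differentiable_continuous
  (smooth_differentiable (smooth_derive w (smooth_derive v sf)) Ux).
have e2 : 0 < e / 2 by rewrite divr_gt0.
have n1 : \forall y \near x, `|'D_v ('D_w f) x - 'D_v ('D_w f) y| < e / 2.
  by move/cvgrPdist_lt : c1; apply.
have n2 : \forall y \near x, `|'D_w ('D_v f) x - 'D_w ('D_v f) y| < e / 2.
  by move/cvgrPdist_lt : c2; apply.
have n3 : \forall y \near x, U y by exact: open_nbhs_nbhs.
have : nbhs x ([set y | `|'D_v ('D_w f) x - 'D_v ('D_w f) y| < e / 2] `&`
  ([set y | `|'D_w ('D_v f) x - 'D_w ('D_v f) y| < e / 2] `&` U)).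
  exact: (filterI n1 (filterI n2 n3)).
move=> /nbhs_ballP[r /= r0 Hr].
(* The summand 1 keeps the denominator positive when [v] and [w] both vanish, and makes
   [t * (|v| + |w|) < r] strict. *)
pose t := r / (`|v| + `|w| + 1).
have p0 : 0 < `|v| + `|w| + 1 by rewrite ltr_wpDl// addr_ge0.
have t0 : 0 < t by rewrite divr_gt0.
have tr : t * (`|v| + `|w|) < r.
  by rewrite /t mulrAC ltr_pdivrMr// ltr_pM2l// ltrDl.
have tr' : t * (`|w| + `|v|) < r by rewrite [X in _ * X]addrC.
have [||s st [s' st' E1]] := @second_difference f x v w r t t0 tr.
- by move=> y /Hr[_ [_]]; exact: smooth_differentiable.
- by move=> y /Hr[_ [_]]; apply: smooth_differentiable; apply: smooth_derive.
have [||q qt [q' qt' E2]] := @second_difference f x w v r t t0 tr'.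
- by move=> y /Hr[_ [_]]; exact: smooth_differentiable.
- by move=> y /Hr[_ [_]]; apply: smooth_differentiable; apply: smooth_derive.
have E : 'D_w ('D_v f) (x + s *: v + s' *: w) = 'D_v ('D_w f) (x + q *: w + q' *: v).
  have t2 : t ^+ 2 != 0 by rewrite expf_neq0// gt_eqF.
  apply: (mulfI t2); apply: (etrans (esym E1)); apply: etrans E2.
  by rewrite [_ + t *: w + _]addrAC; ring.
have [+ _] := Hr _ (ball_line x tr' qt qt').
have [_ [+ _]] := Hr _ (ball_line x tr st st').
rewrite /= E => h2 h1.
exact: ltW (dist_split h1 h2).
Qed.

Lemma derive0_near_cst (U : set V) f x : open U -> U x ->
  (forall y, U y -> differentiable f y) ->
  (forall y v, U y -> 'D_v f y = 0) -> \forall y \near x, f y = f x.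
Proof.
move=> oU Ux df d0.
have : \forall y \near x, U y by exact: open_nbhs_nbhs.
move=> /nbhs_ballP[r /= r0 Hr].
apply/nbhs_ballP; exists r => //= y xy.
pose v := y - x.
have sU (s : R) : s \in `[0, 1]%R -> U (x + s *: v).
  rewrite in_itv/= => /andP[s0 s1]; apply: Hr.
  move: xy; rewrite -!ball_normE /ball_/= opprD addrA subrr sub0r normrN.
  rewrite normrZ distrC ger0_norm//; apply: le_lt_trans.
  by rewrite ler_piMl.
have dl (s : R) : s \in `[0, 1]%R -> is_derive s 1 (fun s => f (x + s *: v)) 0.
  move=> s01; rewrite -(d0 _ v (sU _ s01)); apply: is_derive_line.
  by apply/diff_derivable/df/sU.
have [s _] := MVT_closed ltr01 dl.
rewrite mul0r scale1r scale0r addr0 /v addrCA subrr addr0.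
by move/eqP; rewrite subr_eq0 => /eqP.
Qed.

End Calculus.

(** * Chain rule and matrix inversion in coordinates *)

Section Partial.
Variables (R : realType).

Lemma differentiable_row (V : normedModType R) m (F : V -> 'rV[R]_m) x :
  (forall a, differentiable (fun y => F y 0 a) x) -> differentiable F x.
Proof.
move=> dF; rewrite (_ : F = \sum_(a < m) (fun y => F y 0 a *: delta_mx 0 a)).
  by apply: differentiable_sum => a; exact: differentiableZl.
by apply/funext => y; rewrite fct_sumE -row_sum_delta.
Qed.

Lemma derive_row_comp (V : normedModType R) m (F : V -> 'rV[R]_m)
    (G : 'rV[R]_m -> R) x v :
  (forall a, differentiable (fun y => F y 0 a) x) -> differentiable G (F x) ->
  'D_v (fun y => G (F y)) x
    = \sum_(a < m) 'D_v (fun y => F y 0 a) x * partial a G (F x).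
Proof.
move=> dF dG; have dF' := differentiable_row dF.
rewrite deriveE; last exact: (differentiable_comp dF' dG).
rewrite [in LHS](_ : 'd _ _ = 'd (G \o F) x)//= diff_comp//=.
rewrite [X in 'd G _ X]row_sum_delta linear_sum; apply: eq_bigr => a _.
rewrite linearZ/= -deriveE// [X in _ * X]/(partial a G (F x)); congr (_ * _).
  by rewrite derive_mx ?mxE//; exact: diff_derivable.
by rewrite deriveE.
Qed.

Lemma differentiable_det (V : normedModType R) n (A : V -> 'M[R]_n) x :
  (forall i j, differentiable (fun y => A y i j) x) ->
  differentiable (fun y => \det (A y)) x.
Proof.
move=> dA; apply: differentiable_bigsum => s; apply: differentiableM => //.
by apply: differentiable_bigprod => i; exact: dA.
Qed.

(** Cramer's rule. [invmx] follows the cofactor formula only at invertible matrices and returns its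
    argument elsewhere, hence the invertibility near [x]. *)
Lemma differentiable_invmx (V : normedModType R) n (A : V -> 'M[R]_n) x :
  (forall i j, differentiable (fun y => A y i j) x) ->
  (\forall y \near x, A y \in unitmx) ->
  forall i j, differentiable (fun y => invmx (A y) i j) x.
Proof.
move=> dA uA i j.
have uAx : \det (A x) != 0 by rewrite -unitfE -unitmxE; exact: nbhs_singleton uA.
have : differentiable (fun y => (\det (A y))^-1 * cofactor (A y) j i) x.
  apply: differentiableM; first exact/differentiableV/uAx/differentiable_det.
  apply: differentiableM => //; apply: differentiable_det => k l.
  by under eq_fun do rewrite !mxE; exact: dA.
apply: near_eq_differentiable; near=> y.
by rewrite /invmx (near uA y)// !mxE.
Unshelve. all: by end_near. Qed.

End Partial.

(** * Christoffel symbols and the Gauss formula in coordinates *)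

Section Christoffel.
Variables (R : realType).

(** The body of [christoffel] freed from charts: [chr (g c)] and [christoffel g c] are convertible,
    and maps between open sets of coordinate spaces can be treated without atlases. *)
Definition chr n (g : 'rV[R]_n -> 'M[R]_n) x (k i j : 'I_n) : R :=
  2^-1 * \sum_(l < n) invmx (g x) k l *
    (partial i (fun y => g y j l) x + partial j (fun y => g y i l) x
     - partial l (fun y => g y i j) x).

(** Lowering the upper index cancels the inverse matrix and leaves the Christoffel symbol of the
    first kind. *)
Lemma chr_lower n (g : 'rV[R]_n -> 'M[R]_n) x i j l :
  g x \in unitmx -> (g x)^T = g x ->
  \sum_(k < n) chr g x k i j * g x k l
    = 2^-1 * (partial i (fun y => g y j l) x + partial j (fun y => g y i l) x
              - partial l (fun y => g y i j) x).
Proof.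
move=> gu gs.
pose b : 'cV[R]_n := \col_l (partial i (fun y => g y j l) x
  + partial j (fun y => g y i l) x - partial l (fun y => g y i j) x).
have gC p q : g x p q = g x q p by rewrite -[in LHS]gs mxE.
have chrE k : chr g x k i j = 2^-1 * (invmx (g x) *m b) k 0.
  by rewrite /chr mxE; congr (_ * _); apply: eq_bigr => m _; rewrite !mxE.
transitivity (2^-1 * (g x *m (invmx (g x) *m b)) l 0).
  rewrite [in RHS]mxE mulr_sumr; apply: eq_bigr => k _; rewrite chrE -mulrA.
  by rewrite (gC k l); congr (_ * _); exact: mulrC.
by rewrite mulKVmx// mxE.
Qed.

Section Forms.
Variable m : nat.
Implicit Types (G : 'I_m -> 'I_m -> R) (u v w : 'I_m -> R).

(** Vectors are plain functions on indices and [G] is any array, so that rows of matrices, second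
    derivatives of maps and derivatives of the metric can all be inserted directly. *)
Definition bform G v w := \sum_(a < m) \sum_(b < m) v a * G a b * w b.

Lemma bformBl G v v' w : bform G (fun a => v a - v' a) w = bform G v w - bform G v' w.
Proof.
rewrite -sumrB; apply: eq_bigr => a _; rewrite -sumrB; apply: eq_bigr => b _.
by rewrite !mulrBl.
Qed.

Lemma bformDl G v v' w : bform G (fun a => v a + v' a) w = bform G v w + bform G v' w.
Proof.
rewrite -big_split; apply: eq_bigr => a _; rewrite -big_split; apply: eq_bigr => b _.
by rewrite /= !mulrDl.
Qed.

Lemma bformZl G k v w : bform G (fun a => k * v a) w = k * bform G v w.
Proof.
rewrite mulr_sumr; apply: eq_bigr => a _; rewrite mulr_sumr; apply: eq_bigr => b _.
by rewrite !mulrA.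
Qed.

Lemma bform_suml G (J : Type) (r : seq J) (v : J -> 'I_m -> R) w :
  bform G (fun a => \sum_(j <- r) v j a) w = \sum_(j <- r) bform G (v j) w.
Proof.
rewrite exchange_big; apply: eq_bigr => a _ /=.
rewrite exchange_big; apply: eq_bigr => b _ /=.
by rewrite !mulr_suml.
Qed.

Lemma bformC G v w : (forall a b, G a b = G b a) -> bform G v w = bform G w v.
Proof.
move=> GC; rewrite /bform exchange_big; apply: eq_bigr => a _; apply: eq_bigr => b _.
by rewrite (GC b a); ring.
Qed.

Variables (G : 'rV[R]_m -> 'M[R]_m) (z : 'rV[R]_m).

Definition dmet u (a b : 'I_m) : R :=
  \sum_(c < m) u c * partial c (fun y => G y a b) z.

(** Koszul's formula for fields with constant components, whose brackets vanish: only the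
    derivatives of the metric remain. *)
Lemma chr_bform u v w : G z \in unitmx -> (G z)^T = G z ->
  bform (G z) (fun a => \sum_(b < m) \sum_(e < m) chr G z a b e * u b * v e) w
    = 2^-1 * (bform (dmet u) v w + bform (dmet v) u w - bform (dmet w) u v).
Proof.
move=> Gu Gs.
have -> : bform (G z) (fun a => \sum_(b < m) \sum_(e < m) chr G z a b e * u b * v e) w
  = \sum_(b < m) \sum_(e < m) \sum_(d < m) u b * v e * w d *
     (2^-1 * (partial b (fun y => G y e d) z + partial e (fun y => G y b d) z
              - partial d (fun y => G y b e) z)).
  rewrite bform_suml; apply: eq_bigr => b _.
  rewrite bform_suml; apply: eq_bigr => e _.
  rewrite /bform exchange_big; apply: eq_bigr => d _ /=.
  rewrite -chr_lower// mulr_sumr; apply: eq_bigr => a _.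
  by ring.
have E1 : bform (dmet u) v w = \sum_(b < m) \sum_(e < m) \sum_(d < m)
     u b * v e * w d * partial b (fun y => G y e d) z.
  rewrite /bform exchange_big [RHS](eq_bigr (fun b => \sum_(d < m) \sum_(e < m)
     u b * v e * w d * partial b (fun y => G y e d) z)) => [|b _]; last exact: exchange_big.
  rewrite [RHS]exchange_big; apply: eq_bigr => d _ /=.
  rewrite [RHS]exchange_big; apply: eq_bigr => e _ /=.
  rewrite /dmet mulr_sumr mulr_suml; apply: eq_bigr => b _.
  by rewrite mulrA (mulrC (v e)) -!mulrA [_ * w d]mulrC.
have E2 : bform (dmet v) u w = \sum_(b < m) \sum_(e < m) \sum_(d < m)
     u b * v e * w d * partial e (fun y => G y b d) z.
  apply: eq_bigr => b _; rewrite [RHS]exchange_big; apply: eq_bigr => d _ /=.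
  rewrite /dmet mulr_sumr mulr_suml; apply: eq_bigr => e _.
  by rewrite mulrA -!mulrA [_ * w d]mulrC.
have E3 : bform (dmet w) u v = \sum_(b < m) \sum_(e < m) \sum_(d < m)
     u b * v e * w d * partial d (fun y => G y b e) z.
  apply: eq_bigr => b _; apply: eq_bigr => e _ /=.
  rewrite /dmet mulr_sumr mulr_suml; apply: eq_bigr => d _.
  by rewrite -!mulrA; congr (_ * _); rewrite mulrA mulrC.
rewrite E1 E2 E3 -big_split -sumrB mulr_sumr; apply: eq_bigr => b _ /=.
rewrite -big_split -sumrB mulr_sumr; apply: eq_bigr => e _ /=.
rewrite -big_split -sumrB mulr_sumr; apply: eq_bigr => d _ /=.
rewrite -mulrDr -mulrBr; exact: mulrCA.
Qed.

End Forms.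

Section Gauss.
Variables (n m : nat) (U : set 'rV[R]_n) (F : 'rV[R]_n -> 'rV[R]_m).
Variables (g : 'rV[R]_n -> 'M[R]_n) (G : 'rV[R]_m -> 'M[R]_m) (s : R).
Hypothesis oU : open U.
Hypothesis sF : forall a, smooth_on U (fun y => F y 0 a).
Hypothesis dG : forall y a b, U y -> differentiable (fun z => G z a b) (F y).
Hypothesis Gu : forall y, U y -> G (F y) \in unitmx.
Hypothesis Gs : forall y, U y -> (G (F y))^T = G (F y).
Hypothesis gu : forall y, U y -> g y \in unitmx.
Hypothesis s0 : s != 0.

Definition dmap i y (a : 'I_m) : R := partial i (fun z => F z 0 a) y.

Hypothesis gE : forall y j l, U y ->
  g y j l = s * bform (G (F y)) (dmap j y) (dmap l y).

Lemma partial_comp i (H : 'rV[R]_m -> R) x : U x -> differentiable H (F x) ->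
  partial i (fun y => H (F y)) x = \sum_(c < m) dmap i x c * partial c H (F x).
Proof.
move=> Ux dH; apply: derive_row_comp => // a.
exact: (smooth_differentiable (sF a)).
Qed.

Lemma smooth_dmap i a : smooth_on U (fun y => dmap i y a).
Proof. exact: smooth_derive. Qed.

Lemma partial_dmapC i j x a : U x ->
  partial i (fun y => dmap j y a) x = partial j (fun y => dmap i y a) x.
Proof. by move=> Ux; apply: derive_swap Ux. Qed.

Lemma derivable_dmap k a x v : U x -> derivable (fun y => dmap k y a) x v.
Proof. exact: (derivable_smooth (smooth_dmap k a)). Qed.

Lemma derivable_metric_comp a b x v : U x -> derivable (fun y => G (F y) a b) x v.
Proof.
move=> Ux; apply: diff_derivable; apply: (@differentiable_comp _ _ _ _ F (fun z => G z a b)).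
  by apply: differentiable_row => c; exact: (smooth_differentiable (sF c) Ux).
exact: dG.
Qed.

Lemma derivable_pullback j l x v : U x ->
  derivable (fun y => bform (G (F y)) (dmap j y) (dmap l y)) x v.
Proof.
move=> Ux; apply: derivable_bigsum => a; apply: derivable_bigsum => b.
apply: derivableM; last exact: derivable_dmap.
by apply: derivableM; [exact: derivable_dmap | exact: derivable_metric_comp].
Qed.

Lemma partial_pullback i j l x : U x ->
  partial i (fun y => bform (G (F y)) (dmap j y) (dmap l y)) x
  = bform (G (F x)) (fun a => partial i (fun y => dmap j y a) x) (dmap l x)
    + bform (dmet G (F x) (dmap i x)) (dmap j x) (dmap l x)
    + bform (G (F x)) (dmap j x) (fun a => partial i (fun y => dmap l y a) x).
Proof.
move=> Ux.
have d1 k a := @derivable_dmap k a x (delta_mx 0 i) Ux.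
have d2 a b := @derivable_metric_comp a b x (delta_mx 0 i) Ux.
rewrite /bform /partial derive_bigsum => [|a]; last first.
  by apply: derivable_bigsum => b; apply: derivableM => //; exact: derivableM.
rewrite -!big_split; apply: eq_bigr => a _ /=.
rewrite derive_bigsum => [|b]; last by apply: derivableM => //; exact: derivableM.
rewrite -!big_split; apply: eq_bigr => b _ /=.
rewrite (derive_mul (derivableM (d1 j a) (d2 a b)) (d1 l b)) (derive_mul (d1 j a) (d2 a b)).
rewrite mulrDl; congr (_ + _ * _ + _); congr (_ * _).
exact: (partial_comp i Ux (dG a b Ux)).
Qed.

(* Koszul's formula for g and for G, compared; the constant s makes the statement
   apply to homotheties as well as to isometric immersions. *)
Lemma gauss_normal i j l x : U x ->
  bform (G (F x)) (fun a => partial i (fun y => dmap j y a) x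
      - \sum_(k < n) chr g x k i j * dmap k x a
      + \sum_(b < m) \sum_(e < m) chr G (F x) a b e * dmap i x b * dmap j x e)
    (dmap l x) = 0.
Proof.
move=> Ux; have Gx := Gs Ux.
have GC a b : G (F x) a b = G (F x) b a by rewrite -[in LHS]Gx mxE.
have gs : (g x)^T = g x.
  by apply/matrixP => a b; rewrite mxE (gE _ _ Ux) (gE _ _ Ux) (bformC _ _ GC).
have pg p q r : partial p (fun y => g y q r) x = s * (
    bform (G (F x)) (fun a => partial p (fun y => dmap q y a) x) (dmap r x)
    + bform (dmet G (F x) (dmap p x)) (dmap q x) (dmap r x)
    + bform (G (F x)) (dmap q x) (fun a => partial p (fun y => dmap r y a) x)).
  rewrite -partial_pullback// -derive_scale; last exact: derivable_pullback.
  apply: near_eq_derive; have : nbhs x U by exact: open_nbhs_nbhs.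
  by apply: filterS => y Uy; rewrite gE.
pose dd p q (a : 'I_m) := partial p (fun y => dmap q y a) x.
have ddC p q : dd p q = dd q p by apply/funext => a; exact: (partial_dmapC p q a Ux).
have bC v w : bform (G (F x)) v w = bform (G (F x)) w v by exact: bformC.
(* The product rule yields three kinds of pairings of a second with a first derivative of [F]. In
   Koszul's combination [B] and [C] cancel and [A] doubles; the terms [T] are those that Koszul's
   formula for [G] contributes. *)
set A := bform (G (F x)) (dd i j) (dmap l x).
pose B := bform (G (F x)) (dd i l) (dmap j x).
pose C := bform (G (F x)) (dd j l) (dmap i x).
pose T p q r := bform (dmet G (F x) (dmap p x)) (dmap q x) (dmap r x).
have E3 (a b c a' c' : R) : a = a' -> c = c' -> s * (a + b + c) = s * (a' + b + c').
  by move=> -> ->.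
have pi : partial i (fun y => g y j l) x = s * (A + T i j l + B).
  exact: (etrans (pg i j l) (E3 _ _ _ _ _ erefl (bC (dmap j x) (dd i l)))).
have Aji : bform (G (F x)) (dd j i) (dmap l x) = A.
  exact: (congr1 (fun v => bform _ v _) (ddC j i)).
have pj : partial j (fun y => g y i l) x = s * (A + T j i l + C).
  exact: (etrans (pg j i l) (E3 _ _ _ _ _ Aji (bC (dmap i x) (dd j l)))).
have Bli : bform (G (F x)) (dd l i) (dmap j x) = B.
  exact: (congr1 (fun v => bform _ v _) (ddC l i)).
have Clj : bform (G (F x)) (dmap i x) (dd l j) = C.
  exact: (etrans (congr1 (bform _ (dmap i x)) (ddC l j)) (bC _ _)).
have pl : partial l (fun y => g y i j) x = s * (B + T l i j + C).
  exact: (etrans (pg l i j) (E3 _ _ _ _ _ Bli Clj)).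
have hS : s * (\sum_(k < n) bform (G (F x)) (fun a => chr g x k i j * dmap k x a) (dmap l x))
    = 2^-1 * (s * (A + T i j l + B) + s * (A + T j i l + C) - s * (B + T l i j + C)).
  have E4 (a b c a' b' c' : R) : a = a' -> b = b' -> c = c' ->
    2^-1 * (a + b - c) = 2^-1 * (a' + b' - c') by move=> -> -> ->.
  apply: etrans (etrans _ (chr_lower i j l (gu Ux) gs)) (E4 _ _ _ _ _ _ pi pj pl).
  by rewrite mulr_sumr; apply: eq_bigr => k _; rewrite bformZl (gE _ _ Ux); exact: mulrCA.
rewrite bformDl bformBl bform_suml (chr_bform _ _ _ (Gu Ux) Gx).
apply: (mulfI s0); rewrite mulr0 mulrDr mulrBr hS.
have E5 (a b c t1 t2 t3 : R) : s * a - 2^-1 * (s * (a + t1 + b) + s * (a + t2 + c)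
  - s * (b + t3 + c)) + s * (2^-1 * (t1 + t2 - t3)) = 0 by field.
exact: (E5 A B C (T i j l) (T j i l) (T l i j)).
Qed.

End Gauss.
End Christoffel.

(** * Curvature under affine maps *)

Section Curvature.
Variables (R : realType).

Definition conn n := 'rV[R]_n -> 'I_n -> 'I_n -> 'I_n -> R.

(** The expression in [riemann], for arbitrary connection coefficients: invariance of curvature uses
    how these transform, not that they come from a metric. *)
Definition curv n (Gam : conn n) x (i j k l : 'I_n) : R :=
  partial i (fun y => Gam y l j k) x - partial j (fun y => Gam y l i k) x
  + \sum_(m < n) (Gam x l i m * Gam x m j k - Gam x l j m * Gam x m i k).

Section Contraction.
Variables (m : nat) (Gam : conn m) (z : 'rV[R]_m).
Implicit Types u v w : 'I_m -> R.

Definition cform u v (a : 'I_m) : R :=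
  \sum_(b < m) \sum_(e < m) Gam z a b e * u b * v e.

(** The derivative of [Gam] along [u], applied to [v] and [w]. *)
Definition dform u v w (a : 'I_m) : R := \sum_(b < m) \sum_(e < m)
  (\sum_(c < m) u c * partial c (fun y => Gam y a b e) z) * v b * w e.

Lemma cformBr u v v' a : cform u (fun b => v b - v' b) a = cform u v a - cform u v' a.
Proof.
rewrite -sumrB; apply: eq_bigr => b _; rewrite -sumrB; apply: eq_bigr => e _.
exact: mulrBr.
Qed.

Lemma cform_sumr u n (k : 'I_n -> R) (v : 'I_n -> 'I_m -> R) a :
  cform u (fun b => \sum_(j < n) k j * v j b) a = \sum_(j < n) k j * cform u (v j) a.
Proof.
transitivity (\sum_(b < m) \sum_(e < m) \sum_(j < n) Gam z a b e * u b * (k j * v j e)).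
  by apply: eq_bigr => b _; apply: eq_bigr => e _; rewrite mulr_sumr.
under eq_bigr do rewrite exchange_big; rewrite exchange_big /=.
apply: eq_bigr => j _; rewrite mulr_sumr; apply: eq_bigr => b _.
by rewrite mulr_sumr; apply: eq_bigr => e _; ring.
Qed.

Lemma curv_contract u v w a :
  \sum_(b < m) \sum_(c < m) \sum_(e < m) curv Gam z b c e a * u b * v c * w e
  = dform u v w a - dform v u w a + cform u (cform v w) a - cform v (cform u w) a.
Proof.
have E1 : dform u v w a = \sum_(b < m) \sum_(c < m) \sum_(e < m)
    partial b (fun y => Gam y a c e) z * u b * v c * w e.
  rewrite [RHS]exchange_big; apply: eq_bigr => c _ /=.
  rewrite [RHS]exchange_big; apply: eq_bigr => e _ /=.
  rewrite !mulr_suml; apply: eq_bigr => b _.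
  by rewrite [u b * _]mulrC.
have E2 : dform v u w a = \sum_(b < m) \sum_(c < m) \sum_(e < m)
    partial c (fun y => Gam y a b e) z * u b * v c * w e.
  apply: eq_bigr => b _; rewrite [RHS]exchange_big; apply: eq_bigr => e _ /=.
  rewrite !mulr_suml; apply: eq_bigr => c _.
  by rewrite [v c * _]mulrC [_ * v c * u b]mulrAC.
have E3 : cform u (cform v w) a = \sum_(b < m) \sum_(c < m) \sum_(e < m)
    (\sum_(d < m) Gam z a b d * Gam z d c e) * u b * v c * w e.
  apply: eq_bigr => b _.
  transitivity (\sum_(d < m) \sum_(c < m) \sum_(e < m)
      Gam z a b d * Gam z d c e * u b * v c * w e).
    apply: eq_bigr => d _; rewrite mulr_sumr; apply: eq_bigr => c _.
    by rewrite mulr_sumr; apply: eq_bigr => e _; ring.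
  rewrite exchange_big; apply: eq_bigr => c _ /=.
  rewrite exchange_big; apply: eq_bigr => e _ /=.
  by rewrite !mulr_suml.
have E4 : cform v (cform u w) a = \sum_(b < m) \sum_(c < m) \sum_(e < m)
    (\sum_(d < m) Gam z a c d * Gam z d b e) * u b * v c * w e.
  rewrite [RHS]exchange_big; apply: eq_bigr => c _ /=.
  transitivity (\sum_(d < m) \sum_(b < m) \sum_(e < m)
      Gam z a c d * Gam z d b e * u b * v c * w e).
    apply: eq_bigr => d _; rewrite mulr_sumr; apply: eq_bigr => b _.
    by rewrite mulr_sumr; apply: eq_bigr => e _; ring.
  rewrite exchange_big; apply: eq_bigr => b _ /=.
  rewrite exchange_big; apply: eq_bigr => e _ /=.
  by rewrite !mulr_suml.
rewrite E1 E2 E3 E4 -sumrB -big_split -sumrB; apply: eq_bigr => b _ /=.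
rewrite -sumrB -big_split -sumrB; apply: eq_bigr => c _ /=.
rewrite -sumrB -big_split -sumrB; apply: eq_bigr => e _ /=.
by rewrite /curv sumrB; ring.
Qed.

End Contraction.

Section Naturality.
Variables (n m : nat) (U : set 'rV[R]_n) (F : 'rV[R]_n -> 'rV[R]_m).
Variables (Gam : conn n) (Gam' : conn m).
Hypothesis oU : open U.
Hypothesis sF : forall a, smooth_on U (fun y => F y 0 a).
Hypothesis dGam : forall y k i j, U y -> differentiable (fun z => Gam z k i j) y.
Hypothesis dGam' : forall y a b e, U y -> differentiable (fun z => Gam' z a b e) (F y).
(** Vanishing of the covariant derivative of dF, solved for the second derivatives of [F]. *)
Hypothesis affine : forall y i j a, U y ->
  partial i (fun z => dmap F j z a) y
    = \sum_(k < n) Gam y k i j * dmap F k y a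
      - cform Gam' (F y) (dmap F i y) (dmap F j y) a.

Let d1 k a x v (Ux : U x) : derivable (fun y => dmap F k y a) x v.
Proof. exact: (derivable_smooth (smooth_dmap sF k a)). Qed.

Let d2 k i j x v (Ux : U x) : derivable (fun y => Gam y k i j) x v.
Proof. exact/diff_derivable/dGam. Qed.

Let d3 a b e x v (Ux : U x) : derivable (fun y => Gam' (F y) a b e) x v.
Proof.
apply: diff_derivable; apply: (@differentiable_comp _ _ _ _ F (fun z => Gam' z a b e)).
  by apply: differentiable_row => c; exact: (smooth_differentiable (sF c) Ux).
exact: dGam'.
Qed.

Let dd x i j (a : 'I_m) := partial i (fun z => dmap F j z a) x.

(** The second derivatives [dd] are left unexpanded: the term with [dd x i j] is symmetric in [i]
    and [j] and disappears on antisymmetrization. *)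
Lemma partial_affine i j k a x : U x ->
  partial i (fun y => dd y j k a) x
  = \sum_(l < n) partial i (fun y => Gam y l j k) x * dmap F l x a
    + \sum_(l < n) Gam x l j k * dd x i l a
    - (dform Gam' (F x) (dmap F i x) (dmap F j x) (dmap F k x) a
       + cform Gam' (F x) (dd x i j) (dmap F k x) a
       + cform Gam' (F x) (dmap F j x) (dd x i k) a).
Proof.
move=> Ux; rewrite /partial.
rewrite (@near_eq_derive _ _ _ _ (fun y => \sum_(l < n) Gam y l j k * dmap F l y a
      - cform Gam' (F y) (dmap F j y) (dmap F k y) a)); last first.
  have : nbhs x U by exact: open_nbhs_nbhs.
  by apply: filterS => y Uy; exact: affine.
have dA l : derivable (fun y => Gam y l j k * dmap F l y a) x (delta_mx 0 i).
  by apply: derivableM; [exact: d2 | exact: d1].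
have dB b e : derivable (fun y => Gam' (F y) a b e * dmap F j y b) x (delta_mx 0 i).
  by apply: derivableM; [exact: d3 | exact: d1].
have dC b e : derivable (fun y => Gam' (F y) a b e * dmap F j y b * dmap F k y e) x (delta_mx 0 i).
  by apply: derivableM; [exact: dB | exact: d1].
have dD b : derivable (fun y => \sum_(e < m) Gam' (F y) a b e * dmap F j y b * dmap F k y e) x
   (delta_mx 0 i) by apply: derivable_bigsum => e; exact: dC.
rewrite derive_sub; [|by apply: derivable_bigsum|by apply: derivable_bigsum].
rewrite derive_bigsum//; congr (_ - _).
  rewrite -big_split; apply: eq_bigr => l _ /=.
  exact: (derive_mul (@d2 l j k x (delta_mx 0 i) Ux) (@d1 l a x (delta_mx 0 i) Ux)).
rewrite derive_bigsum// -!big_split; apply: eq_bigr => b _ /=.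
rewrite derive_bigsum// -!big_split; apply: eq_bigr => e _ /=.
rewrite (derive_mul (dB b e) (@d1 k e x (delta_mx 0 i) Ux)).
rewrite (derive_mul (@d3 a b e x (delta_mx 0 i) Ux) (@d1 j b x (delta_mx 0 i) Ux)).
have -> : 'D_(delta_mx 0 i) (fun y => Gam' (F y) a b e) x
    = \sum_(c < m) dmap F i x c * partial c (fun z => Gam' z a b e) (F x).
  apply: derive_row_comp; last exact: dGam'.
  by move=> c; exact: (smooth_differentiable (sF c) Ux).
by rewrite mulrDl.
Qed.

(** Bookkeeping for the antisymmetrized identity: [t] and [p] hold the derivatives of [Gam] and
    [Gam'], [r] and [k] their quadratic terms, [s] the mixed products and [q] the symmetric term.
    After substitution the mixed products occur equally on both sides and cancel. *)
Let curv_natural_combine (t1 t2 g1 g2 p1 p2 q q' c1 c2 r1 r2 s1 s2 k1 k2 r : R) :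
  t1 + g1 - (p1 + q + c1) = t2 + g2 - (p2 + q' + c2) -> q' = q ->
  g1 = r1 - s1 -> g2 = r2 - s2 -> c1 = s2 - k1 -> c2 = s1 - k2 ->
  r = t1 - t2 + (r1 - r2) -> r = p1 - p2 + k2 - k1.
Proof. by move=> S qE g1E g2E c1E c2E ->; move: S; rewrite qE g1E g2E c1E c2E => S; lra. Qed.

(* Differentiate [affine] once more and antisymmetrize: the third derivatives of
   F drop out. *)
Lemma curv_natural i j k a x : U x ->
  \sum_(l < n) curv Gam x i j k l * dmap F l x a
  = \sum_(b < m) \sum_(c < m) \sum_(e < m) curv Gam' (F x) b c e a
      * dmap F i x b * dmap F j x c * dmap F k x e.
Proof.
move=> Ux; rewrite curv_contract.
have ddC p q : dd x p q = dd x q p.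
  by apply/funext => b; exact: (partial_dmapC oU sF p q b Ux).
have S : partial i (fun y => dd y j k a) x = partial j (fun y => dd y i k a) x.
  exact: (derive_swap _ _ oU (smooth_dmap sF k a) Ux).
have cdd p q r : cform Gam' (F x) (dmap F p x) (dd x q r) a
   = \sum_(l < n) Gam x l q r * cform Gam' (F x) (dmap F p x) (dmap F l x) a
     - cform Gam' (F x) (dmap F p x) (cform Gam' (F x) (dmap F q x) (dmap F r x)) a.
  rewrite -cform_sumr -cformBr; congr (cform _ _ _ _ _).
  by apply/funext => b; exact: affine.
have gdd p q r : \sum_(l < n) Gam x l q r * dd x p l a
   = \sum_(l < n) (\sum_(h < n) Gam x l p h * Gam x h q r) * dmap F l x a
     - \sum_(l < n) Gam x l q r * cform Gam' (F x) (dmap F p x) (dmap F l x) a.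
  rewrite (eq_bigr (fun l => \sum_(h < n) Gam x l q r * (Gam x h p l * dmap F h x a)
    - Gam x l q r * cform Gam' (F x) (dmap F p x) (dmap F l x) a)) => [|l _].
    rewrite sumrB exchange_big; congr (_ - _); apply: eq_bigr => h _ /=.
    by rewrite mulr_suml; apply: eq_bigr => l _; ring.
  by rewrite -mulr_sumr -mulrBr; congr (_ * _); exact: affine.
have curvE : \sum_(l < n) curv Gam x i j k l * dmap F l x a
  = \sum_(l < n) partial i (fun y => Gam y l j k) x * dmap F l x a
    - \sum_(l < n) partial j (fun y => Gam y l i k) x * dmap F l x a
    + (\sum_(l < n) (\sum_(h < n) Gam x l i h * Gam x h j k) * dmap F l x a
       - \sum_(l < n) (\sum_(h < n) Gam x l j h * Gam x h i k) * dmap F l x a).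
  rewrite -!sumrB -big_split; apply: eq_bigr => l _ /=.
  by rewrite /curv sumrB mulrDl !mulrBl.
have cddC : cform Gam' (F x) (dd x j i) (dmap F k x) a
    = cform Gam' (F x) (dd x i j) (dmap F k x) a.
  exact: (congr1 (fun u => cform Gam' (F x) u (dmap F k x) a) (ddC j i)).
have {}S := etrans (esym (partial_affine i j k a Ux))
  (etrans S (partial_affine j i k a Ux)).
exact: (curv_natural_combine S cddC (gdd i j k) (gdd j i k) (cdd j i k) (cdd i j k) curvE).
Qed.

End Naturality.

Definition ric n (Gam : conn n) x (j k : 'I_n) : R := \sum_(i < n) curv Gam x i j k i.

(** A trace does not depend on the basis: inserting [K] times its inverse moves the contracted pair
    of indices to the target. This requires a square Jacobian, hence equal dimensions. *)
Lemma ric_natural n (Gam Gam' : conn n) (K : 'M[R]_n) (x z : 'rV[R]_n) :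
  K \in unitmx ->
  (forall i j k a, \sum_(l < n) curv Gam x i j k l * K l a
    = \sum_(b < n) \sum_(c < n) \sum_(e < n) curv Gam' z b c e a
      * K i b * K j c * K k e) ->
  forall j k, ric Gam x j k = \sum_(c < n) \sum_(e < n) K j c * ric Gam' z c e * K k e.
Proof.
move=> Ku H j k; pose L := invmx K.
have KL l i : \sum_(a < n) K l a * L a i = (l == i)%:R.
  by have := congr1 (fun M : 'M[R]_n => M l i) (mulmxV Ku); rewrite !mxE.
have LK a b : \sum_(i < n) L a i * K i b = (a == b)%:R.
  by have := congr1 (fun M : 'M[R]_n => M a b) (mulVmx Ku); rewrite !mxE.
transitivity (\sum_(i < n) \sum_(a < n) L a i * (\sum_(l < n) curv Gam x i j k l * K l a)).
  apply: eq_bigr => i _.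
  transitivity (\sum_(l < n) curv Gam x i j k l * (\sum_(a < n) K l a * L a i)).
    rewrite (bigD1 i)//= [X in _ + X]big1 ?addr0 => [|l li]; first by rewrite KL eqxx mulr1.
    by rewrite KL (negbTE li) mulr0.
  under eq_bigr do rewrite mulr_sumr; rewrite exchange_big; apply: eq_bigr => a _ /=.
  by rewrite mulr_sumr; apply: eq_bigr => l _; ring.
transitivity (\sum_(a < n) \sum_(b < n) (a == b)%:R *
    (\sum_(c < n) \sum_(e < n) curv Gam' z b c e a * K j c * K k e)).
  rewrite exchange_big; apply: eq_bigr => a _ /=.
  transitivity (\sum_(i < n) \sum_(b < n) L a i * K i b *
      (\sum_(c < n) \sum_(e < n) curv Gam' z b c e a * K j c * K k e)).
    apply: eq_bigr => i _; rewrite H mulr_sumr; apply: eq_bigr => b _.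
    rewrite !mulr_sumr; apply: eq_bigr => c _; rewrite !mulr_sumr; apply: eq_bigr => e _.
    by ring.
  by rewrite exchange_big; apply: eq_bigr => b _ /=; rewrite -mulr_suml LK.
transitivity (\sum_(a < n) \sum_(c < n) \sum_(e < n) curv Gam' z a c e a * K j c * K k e).
  apply: eq_bigr => a _; rewrite (bigD1 a)//= eqxx mul1r [X in _ + X]big1 ?addr0// => b ba.
  by rewrite eq_sym (negbTE ba) mul0r.
rewrite exchange_big; apply: eq_bigr => c _ /=; rewrite exchange_big; apply: eq_bigr => e _ /=.
by rewrite /ric mulr_sumr mulr_suml; apply: eq_bigr => a _; ring.
Qed.

End Curvature.

(** * The Ricci curvature under a sectional curvature bound *)

Section Positive.
Variable R : realType.

Definition qf n (P : 'M[R]_n) (v : 'rV[R]_n) : R := (v *m P *m v^T) 0 0.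

Definition posdef n (P : 'M[R]_n) := forall v : 'rV[R]_n, v != 0 -> 0 < qf P v.

Lemma trE11 (P : 'M[R]_1) : \tr P = P 0 0.
Proof. by rewrite /mxtrace big_ord1. Qed.

Lemma qfD n (P Q : 'M[R]_n) v : qf (P + Q) v = qf P v + qf Q v.
Proof. by rewrite /qf mulmxDr mulmxDl mxE. Qed.

Lemma qfZ n k (P : 'M[R]_n) v : qf (k *: P) v = k * qf P v.
Proof. by rewrite /qf -scalemxAr -scalemxAl mxE. Qed.

Lemma qfN n (P : 'M[R]_n) v : qf (- P) v = - qf P v.
Proof. by rewrite -scaleN1r qfZ mulN1r. Qed.

Lemma tr_mul_row_col n (r : 'rV[R]_n) (C : 'M[R]_n) : \tr (r^T *m r *m C) = qf C r.
Proof. by rewrite -mulmxA mxtrace_mulC trE11. Qed.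

(* Split off from P the rank one part a^-1 r^T r, where r is the first row and
   a > 0 the first entry; what remains is the Schur complement of a. *)
Lemma trace_mul_ge0 n (P C : 'M[R]_n) : P^T = P -> posdef P ->
  (forall v, 0 <= qf C v) -> 0 <= \tr (P *m C).
Proof.
elim: n P C => [|n IH]; first by move=> P C _ _ _; rewrite /mxtrace big_ord0.
rewrite -[n.+1]/(1 + n)%N => P C PT Ppos Cpos.
pose r : 'rV[R]_(1 + n) := usubmx P.
pose a := ulsubmx P 0 0; pose b : 'rV[R]_n := rsubmx r.
have a0 : 0 < a.
  have e0 : (delta_mx 0 0 : 'rV[R]_(1 + n)) != 0.
    by apply/eqP => /rowP/(_ 0)/eqP; rewrite !mxE eqxx oner_eq0.
  by have := Ppos _ e0; rewrite /qf trmx_delta -rowE -colE /a !mxE !lshift0.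
pose D := drsubmx P.
have PE : P = block_mx a%:M b b^T D.
  rewrite -[LHS](submxK) [ulsubmx P]mx11_scalar; congr block_mx.
  by apply/matrixP => i j; rewrite !mxE -[in LHS]PT mxE.
have rE : r = row_mx a%:M b.
  by rewrite /r [in LHS]PE /block_mx col_mxKu.
pose S := D - a^-1 *: (b^T *m b).
have PS : P = a^-1 *: (r^T *m r) + block_mx 0 0 0 S.
  rewrite {1}PE rE tr_row_mx mul_col_row scale_block_mx add_block_mx !addr0.
  rewrite tr_scalar_mx mul_mx_scalar !mul_scalar_mx -?scale_scalar_mx.
  rewrite !scalerA mulVf ?gt_eqF// !scale1r.
  by rewrite /S addrC subrK mul_mx_scalar scalerA mulVf ?gt_eqF// scale1r.
have Dpos : posdef S.
  (* The first component is chosen so that [v] is annihilated by [r]; the rank one part then drops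
     out and [P] on [v] takes the value of [S] on [w]. *)
  move=> w w0; pose v : 'rV[R]_(1 + n) := row_mx (- a^-1 *: (w *m b^T)) w.
  have v0 : v != 0 by apply: contra_neq w0 => v0; rewrite -[w](row_mxKr (- a^-1 *: (w *m b^T))) -/v v0 linear0.
  have := Ppos v v0; rewrite {1}PS qfD qfZ.
  have -> : qf (r^T *m r) v = 0.
    rewrite /qf mulmxA -mulmxA; suff -> : r *m v^T = 0 by rewrite mulmx0 mxE.
    rewrite rE tr_row_mx mul_row_col mul_scalar_mx linearZ/= scalerA mulrN.
    by rewrite divff ?gt_eqF// scaleN1r trmx_mul trmxK addNr.
  rewrite mulr0 add0r /qf /v mul_row_block !mulmx0 !add0r tr_row_mx.
  by rewrite mul_row_col mul0mx add0r.
rewrite PS mulmxDl mxtraceD -scalemxAl mxtraceZ tr_mul_row_col addr_ge0//.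
  by rewrite mulr_ge0// invr_ge0 ltW.
rewrite -[C]submxK mulmx_block !mul0mx !addr0 !add0r mxtrace_block.
rewrite trE11 mxE add0r; apply: IH => //.
- by rewrite /S linearB/= linearZ/= trmx_mul trmxK /D trmx_drsub PT.
- move=> w; have := Cpos (row_mx 0 w).
  rewrite /qf -{1}[C]submxK mul_row_block !mul0mx !add0r tr_row_mx.
  by rewrite mul_row_col trmx0 mulmx0 add0r.
Qed.

Lemma posdef_unit n (P : 'M[R]_n) : posdef P -> P \in unitmx.
Proof.
move=> Ppos; rewrite -row_free_unit -kermx_eq0; apply/eqP/row_matrixP => i.
rewrite row0; apply/eqP; apply: contraT => k0.
have := Ppos _ k0; rewrite /qf -row_mul mulmx_ker row0 mul0mx mxE ltxx.
by [].
Qed.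

Lemma posdef_inv n (P : 'M[R]_n) : P^T = P -> posdef P -> posdef (invmx P).
Proof.
move=> PT Ppos v v0; have Pu := posdef_unit Ppos.
have -> : qf (invmx P) v = qf P (v *m invmx P).
  by rewrite /qf mulmxKV// trmx_mul trmx_inv PT mulmxA.
apply: Ppos; apply: contra_neq v0 => v0.
by rewrite -[v](mulmxKV Pu) v0 mul0mx.
Qed.

End Positive.

(** * From sectional to Ricci curvature at a point *)

Section RicciBound.
Variables (R : realType) (n : nat) (T : topologicalType) (A : atlas R n T).
Variables (g : metric A) (c : chart A) (x : 'rV[R]_n).
Hypothesis gT : (g c x)^T = g c x.
Hypothesis gpos : posdef (g c x).

Lemma innerC (v w : 'rV[R]_n) : inner g c x v w = inner g c x w v.
Proof.
have E : (v *m g c x *m w^T)^T = w *m g c x *m v^T by rewrite !trmx_mul trmxK gT mulmxA.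
by rewrite /inner -E [RHS]mxE.
Qed.

Lemma innerDl (u v w : 'rV[R]_n) : inner g c x (u + v) w = inner g c x u w + inner g c x v w.
Proof. by rewrite /inner !mulmxDl mxE. Qed.

Lemma innerZl k (v w : 'rV[R]_n) : inner g c x (k *: v) w = k * inner g c x v w.
Proof. by rewrite /inner -!scalemxAl mxE. Qed.

Lemma inner_gt0 (v : 'rV[R]_n) : v != 0 -> 0 < inner g c x v v.
Proof. exact: gpos. Qed.

Lemma rank2P (v w : 'rV[R]_n) : w != 0 ->
  \rank (col_mx v w) = 2%N \/ exists k, v = k *: w.
Proof.
move=> w0; have [/sub_rVP vw|nvw] := boolP (v <= w)%MS; first by right.
left; apply/eqP; rewrite eqn_leq rank_leq_row/= -addsmxE.
have : (w < v + w)%MS by rewrite /ltmx addsmxSr/= addsmx_sub negb_and nvw.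
by move/rank_ltmx; rewrite rank_rV w0.
Qed.

Lemma cauchy_schwarz_strict (v w : 'rV[R]_n) : \rank (col_mx v w) = 2%N ->
  0 < inner g c x v v * inner g c x w w - inner g c x v w ^+ 2.
Proof.
move=> r2.
have w0 : w != 0.
  apply/eqP => w0; have : (\rank (col_mx v w) <= 1)%N.
    by rewrite -addsmxE w0 addsmx0 rank_leq_row.
  by rewrite r2.
(* Subtracting from [v] its projection to [w] leaves a nonzero vector; its squared length times that
   of [w] is the Gram determinant. *)
pose k := inner g c x v w / inner g c x w w.
have u0 : v + (- k) *: w != 0.
  rewrite scaleNr subr_eq0; apply/eqP => vE.
  have : (\rank (col_mx v w) <= 1)%N.
    rewrite -addsmxE (leq_trans _ (rank_leq_row w))// mxrankS// addsmx_sub submx_refl.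
    by rewrite vE scalemx_sub.
  by rewrite r2.
have ww := inner_gt0 w0; have := inner_gt0 u0.
rewrite innerDl innerZl (innerC v) (innerC w (_ + _)) !innerDl !innerZl (innerC w v).
rewrite -(pmulr_lgt0 _ ww) => /lt_le_trans; apply; rewrite le_eqVlt; apply/orP; left.
by apply/eqP; rewrite /k; field; rewrite gt_eqF.
Qed.

Lemma riemann_anti i j k l : riemann g c x i j k l = - riemann g c x j i k l.
Proof.
rewrite /riemann opprD opprB; congr (_ + _).
by rewrite -sumrN; apply: eq_bigr => m _; rewrite opprB.
Qed.

(* The matrix of v |-> R(v, w)w acting on row vectors *)
Definition jacobi_mx (w : 'rV[R]_n) : 'M[R]_n :=
  \matrix_(i, l) \sum_(j < n) \sum_(k < n) w 0 j * w 0 k * riemann g c x i j k l.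

Lemma riemann_vwwE v w : riemann_vww g c x v w = v *m jacobi_mx w.
Proof.
apply/rowP => l; rewrite !mxE; apply: eq_bigr => i _; rewrite mxE mulr_sumr.
apply: eq_bigr => j _; rewrite mulr_sumr; apply: eq_bigr => k _.
by rewrite !mulrA.
Qed.

Lemma riemann_www w : riemann_vww g c x w w = 0.
Proof.
apply/rowP => l; rewrite !mxE; apply/eqP; rewrite -eqNr -sumrN; apply/eqP.
rewrite [RHS]exchange_big; apply: eq_bigr => i _ /=.
rewrite -sumrN; apply: eq_bigr => j _ /=; rewrite -sumrN; apply: eq_bigr => k _ /=.
by rewrite riemann_anti mulrN opprK [w 0 i * _]mulrC.
Qed.

(** With the denominator cleared the bound also covers [v] proportional to [w], where both sides are
    zero. The trace argument needs a form that is nonnegative on all vectors. *)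
Lemma sectional_quadratic (b : R) p (v w : 'rV[R]_n) :
  dom c p -> x = coords c p -> sectional_le g b%:E -> w != 0 ->
  inner g c x (riemann_vww g c x v w) v
    <= b * (inner g c x v v * inner g c x w w - inner g c x v w ^+ 2).
Proof.
move=> cp xE gb w0; have [r2|[k ->]] := rank2P v w0.
  have den := cauchy_schwarz_strict r2.
  by have := gb c p v w cp r2; rewrite -xE lee_fin /sectional ler_pdivrMr.
rewrite riemann_vwwE -scalemxAl -riemann_vwwE riemann_www scaler0.
rewrite {1}/inner !mul0mx mxE innerZl (innerC _ (k *: w)) !innerZl.
by rewrite le_eqVlt; apply/orP; left; apply/eqP; ring.
Qed.

Lemma ricci_le (b : R) p (w : 'rV[R]_n) :
  dom c p -> x = coords c p -> sectional_le g b%:E -> w != 0 ->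
  qf (ricci g c x) w <= b * (n%:R - 1) * qf (g c x) w.
Proof.
move=> cp xE gb w0; have gu := posdef_unit gpos.
have ricE : qf (ricci g c x) w = \tr (jacobi_mx w).
  rewrite /qf /mxtrace mxE; under [RHS]eq_bigr do rewrite mxE.
  rewrite exchange_big /=; under [RHS]eq_bigr do rewrite exchange_big /=.
  rewrite [RHS]exchange_big; apply: eq_bigr => k _ /=.
  rewrite !mxE mulr_suml; apply: eq_bigr => j _; rewrite !mxE.
  by rewrite mulr_sumr mulr_suml; apply: eq_bigr => i _; ring.
pose r := w *m g c x.
(* [C] is the form v |-> b (|v|^2 |w|^2 - <v,w>^2) - <R(v,w)w, v>. Its trace against the inverse
   metric is b (n - 1) |w|^2 - Ric(w,w), since the trace of the Jacobi operator is Ric(w,w). *)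
pose C := b *: (qf (g c x) w *: g c x - r^T *m r) - jacobi_mx w *m g c x.
have Cpos v : 0 <= qf C v.
  have := sectional_quadratic v cp xE gb w0; rewrite riemann_vwwE -subr_ge0.
  congr (_ <= _); rewrite /C qfD qfN qfZ qfD qfN qfZ; congr (_ * (_ - _) - _).
  - exact: mulrC.
  - rewrite /qf mulmxA -mulmxA mxE big_ord1 expr2; congr (_ * _).
      by rewrite /inner /r trmx_mul gT mulmxA.
    by rewrite innerC /inner /r.
  - by rewrite /qf /inner !mulmxA.
have := trace_mul_ge0 _ (posdef_inv gT gpos) Cpos; rewrite trmx_inv gT => /(_ erefl).
rewrite /C mulmxBr -scalemxAr mulmxBr -scalemxAr mulVmx// mxtraceD mxtraceZ.
rewrite mxtraceD !raddfN/= mxtraceZ mxtrace1.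
have -> : \tr (invmx (g c x) *m (jacobi_mx w *m g c x)) = qf (ricci g c x) w.
  by rewrite mxtrace_mulC mulmxK.
have -> : \tr (invmx (g c x) *m (r^T *m r)) = qf (g c x) w.
  rewrite /r trmx_mul gT -mulmxA mulKmx// mxtrace_mulC trE11.
  by rewrite /qf.
rewrite subr_ge0 => /le_trans; apply; rewrite le_eqVlt; apply/orP; left; apply/eqP.
ring.
Qed.

End RicciBound.

(** * Charts *)

Section ManifoldFacts.
Variables (R : realType) (n : nat) (T : topologicalType) (A : atlas R n T).
Hypothesis mA : is_manifold A.
Implicit Types c : chart A.

Lemma dom_open c : open (dom c).
Proof. by have [_ _ /(_ c)[? ? _ _ _] _] := mA. Qed.

Lemma range_open c : open (range_of c).
Proof. by have [_ _ /(_ c)[? ? _ _ _] _] := mA. Qed.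

Lemma coordsK c p : dom c p -> param c (coords c p) = p.
Proof. by have [_ _ /(_ c)[_ _ + _ _] _] := mA; apply. Qed.

Lemma coords_continuous c p : dom c p -> {for p, continuous (coords c)}.
Proof. by have [_ _ /(_ c)[_ _ _ + _] _] := mA; apply. Qed.

Lemma param_continuous c x : range_of c x -> {for x, continuous (param c)}.
Proof. by have [_ _ /(_ c)[_ _ _ _ +] _] := mA; apply. Qed.

Lemma dom_param c x : range_of c x -> dom c (param c x).
Proof. by case=> p cp <-; rewrite coordsK. Qed.

Lemma paramK c x : range_of c x -> coords c (param c x) = x.
Proof. by case=> p cp <-; rewrite coordsK. Qed.

Lemma range_coords c p : dom c p -> range_of c (coords c p).
Proof. by move=> cp; exists p. Qed.

Lemma carrier_open : open (carrier A).
Proof.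
rewrite openE => p [c cp].
have : nbhs p (dom c) by apply: open_nbhs_nbhs; split => //; exact: dom_open.
by apply: filterS => q cq; exists c.
Qed.

Lemma local_domP m (T' : topologicalType) (B : atlas R m T') (u : T -> T') c (d : chart B) x :
  local_dom u c d x <-> [/\ range_of c x, dom c (param c x) & dom d (u (param c x))].
Proof.
split=> [[p [cp dp] <-]|[rx cx dx]].
  by rewrite coordsK//; split=> //; exists p.
by exists (param c x); [split | exact: paramK].
Qed.

Lemma local_dom_open m (T' : topologicalType) (B : atlas R m T') (u : T -> T') c (d : chart B) :
  (forall p, carrier A p -> {for p, continuous u}) -> open (dom d) ->
  open (local_dom u c d).
Proof.
move=> cu od; rewrite openE => x /local_domP[rx cx dx].
have Nu : nbhs (param c x) (u @^-1` dom d).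
  by apply: cu; [exists c | exact: open_nbhs_nbhs].
have Nx : nbhs x (param c @^-1` (u @^-1` dom d)) by exact: param_continuous Nu.
have Nr : nbhs x (range_of c) by apply: open_nbhs_nbhs; split => //; exact: range_open.
apply: filterS (filterI Nx Nr) => y [dy ry].
by apply/local_domP; split=> //; exact: dom_param.
Qed.

Lemma const_of_dfun0 (h : T -> R) : smooth_fun A h -> connected_manifold A ->
  (forall c p, dom c p -> dfun h c (coords c p) = 0) -> einstein_harmonic A h.
Proof.
move=> sh [[p0 cp0] cA] dh0; exists (h p0).
have lc p : carrier A p -> \forall q \near p, h q = h p.
  move=> [c cp].
  have hc y : range_of c y -> forall v, 'D_v (h \o param c) y = 0.
    move=> ry v; have dy : differentiable (h \o param c) y.
      exact: smooth_differentiable (sh c) ry.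
    rewrite deriveE// (row_sum_delta v) linear_sum big1// => i _.
    rewrite linearZ/= -deriveE//.
    have /rowP/(_ i) := dh0 c _ (dom_param ry).
    rewrite (paramK ry) !mxE => E.
    by rewrite [X in _ *: X](_ : _ = 0) ?scaler0.
  have := derive0_near_cst (@range_open c) (range_coords cp)
    (fun y ry => smooth_differentiable (sh c) ry) (fun y v ry => hc y ry v).
  move=> Nx; have Np : \forall q \near p, (h \o param c) (coords c q) = (h \o param c) (coords c p).
    exact: (coords_continuous cp Nx).
  have Nd : nbhs p (dom c) by apply: open_nbhs_nbhs; split => //; exact: dom_open.
  by apply: filterS (filterI Np Nd) => q [/= + cq]; rewrite !coordsK.
have No p : carrier A p -> nbhs p (carrier A).
  by move=> cp; apply: open_nbhs_nbhs; split => //; exact: carrier_open.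
(* The level set through [p0] is open and closed in the carrier: [h] is locally constant, so the set
   where it takes other values is open too. *)
have E : carrier A `&` [set p | h p = h p0] = carrier A.
  apply: cA.
  - by exists p0.
  - exists (carrier A `&` [set p | h p = h p0]); last by rewrite setIA setIid.
    rewrite openE => p [cp hp].
    by apply: filterS (filterI (lc _ cp) (No p cp)) => q [/= E ?]; split=> //=; rewrite E.
  - exists (~` (carrier A `&` [set p | h p != h p0])).
      apply: open_closedC; rewrite openE => p [cp hp].
      by apply: filterS (filterI (lc _ cp) (No p cp)) => q [/= E ?]; split=> //=; rewrite E.
    apply/seteqP; split=> p [cp /= hp]; split=> //=.
      by move=> [_]; rewrite hp eqxx.
    by apply: contrapT => hp'; apply: hp; split=> //; exact/eqP.
by move=> p cp; move: cp; rewrite -E => -[].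
Qed.

End ManifoldFacts.

Section RiemannianFacts.
Variables (R : realType) (n : nat) (T : topologicalType) (A : atlas R n T).
Variable g : metric A.
Hypothesis rg : is_riemannian g.
Implicit Types c : chart A.

Lemma riem_manifold : is_manifold A. Proof. by case: rg. Qed.

Lemma riem_smooth c i j : smooth_on (range_of c) (fun x => g c x i j).
Proof. by case: rg => _ + _ _ _; apply. Qed.

Lemma riem_sym c x : range_of c x -> (g c x)^T = g c x.
Proof. by case: rg => _ _ + _ _; apply. Qed.

Lemma riem_posdef c x : range_of c x -> posdef (g c x).
Proof. by case: rg => _ _ _ + _ rx v; apply. Qed.

Lemma riem_unit c x : range_of c x -> g c x \in unitmx.
Proof. by move=> rx; exact/posdef_unit/riem_posdef. Qed.

Lemma christoffel_differentiable c x k i j : range_of c x ->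
  differentiable (fun y => christoffel g c y k i j) x.
Proof.
move=> rx; apply: differentiableM => //.
have pd a b e : differentiable (partial a (fun y => g c y b e)) x.
  exact: (smooth_differentiable (smooth_derive _ (@riem_smooth c b e)) rx).
apply: differentiable_bigsum => l; apply: differentiableM.
  apply: differentiable_invmx => [a b|]; first exact: (smooth_differentiable (@riem_smooth c a b) rx).
  have : nbhs x (range_of c).
    by apply: open_nbhs_nbhs; split => //; exact: (range_open riem_manifold).
  by apply: filterS => y; exact: riem_unit.
apply: differentiableB; last exact: pd.
by apply: differentiableD; exact: pd.
Qed.

End RiemannianFacts.

(** * The warped metric *)

Lemma derive_along (R : realType) (V : normedModType R) (F : V -> R) (q : R -> R) v y (t : R) :
  (forall h, F (h *: v + y) = q (h + t)) -> 'D_v F y = q^`()%classic t.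
Proof.
move=> E; rewrite /derive1 /derive; set d := (fun h : R => _); set d' := (fun h : R => _).
suff -> : d = d' by [].
apply/funext => h; rewrite /d /d' /= E.
by have := E 0; rewrite scale0r !add0r => ->.
Qed.

Section WarpedMetric.
Variables (R : realType) (n : nat) (I : set R) (f : R -> R) (I_open : open I).
Hypothesis f_smooth : smooth_on I f.
Hypothesis f_gt0 : forall t, I t -> 0 < f t.
Variables (T : topologicalType) (M : atlas R n T) (gM : metric M).
Hypothesis rM : is_riemannian gM.
Variable d : chart M.
Implicit Types y : 'rV[R]_(1 + n).

Let W : 'rV[R]_(1 + n) -> 'M[R]_(1 + n) := warped_metric I f gM d.
(** [o] is the index of the coordinate t, and [r b] runs over the fiber coordinates. *)
Let o : 'I_(1 + n) := lshift n 0.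
Let r (b : 'I_n) : 'I_(1 + n) := rshift 1 b.

Lemma warpedE0r e : (fun y => W y o (r e)) = cst 0.
Proof. by apply/funext => y; rewrite /W /warped_metric block_mxEur mxE. Qed.

Lemma warpedEr0 e : (fun y => W y (r e) o) = cst 0.
Proof. by apply/funext => y; rewrite /W /warped_metric block_mxEdl mxE. Qed.

Lemma warpedE00 : (fun y => W y o o) = cst 1.
Proof. by apply/funext => y; rewrite /W /warped_metric block_mxEul mxE. Qed.

Lemma warpedErr b e : (fun y => W y (r b) (r e))
  = (fun y => f (y 0 o) * f (y 0 o) * gM d (rsubmx y) b e).
Proof.
by apply/funext => y; rewrite /W /warped_metric block_mxEdr mxE expr2 mxE.
Qed.

Lemma partial0_warped y b e : I (y 0 o) ->
  partial o (fun y => W y (r b) (r e)) y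
    = 2 * f (y 0 o) * f^`()%classic (y 0 o) * gM d (rsubmx y) b e.
Proof.
move=> It; rewrite warpedErr.
transitivity ((fun t => f t * f t * gM d (rsubmx y) b e)^`()%classic (y 0 o)); last first.
  have df : derivable f (y 0 o) 1 by exact: derivable_smooth f_smooth It.
  move: (gM d (rsubmx y) b e) => k.
  rewrite derive1E (derive_mul (derivableM df df) (derivable_cst k _ _)) derive_cst.
  by rewrite (derive_mul df df) -derive1E mulr0 addr0 /cst; ring.
apply: derive_along => h.
rewrite linearD linearZ /= (_ : rsubmx (delta_mx 0 o) = 0) ?scaler0 ?add0r.
  by rewrite !mxE !eqxx mulr1.
by apply/rowP => k; rewrite !mxE eqxx /=.
Qed.

Lemma warped_sym y : range_of d (rsubmx y) -> (W y)^T = W y.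
Proof.
move=> ry; rewrite /W /warped_metric tr_block_mx !trmx0 trmx1 linearZ/=.
by rewrite (riem_sym rM ry).
Qed.

Lemma warped_unit y : I (lsubmx y 0 0) -> range_of d (rsubmx y) -> W y \in unitmx.
Proof.
move=> It ry; rewrite unitmxE /W /warped_metric det_ublock det1 mul1r detZ.
rewrite unitrM; apply/andP; split; last by rewrite -unitmxE (riem_unit rM ry).
by rewrite unitfE !expf_neq0// gt_eqF// f_gt0.
Qed.

Lemma warped_differentiable y a b : I (y 0 o) -> range_of d (rsubmx y) ->
  differentiable (fun y => W y a b) y.
Proof.
move=> It ry.
have dc : differentiable (fun y : 'rV[R]_(1 + n) => f (y 0 o)) y.
  apply: (@differentiable_comp _ _ _ _ (fun y : 'rV[R]_(1 + n) => y 0 o) f).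
    exact: differentiable_coord.
  exact: smooth_differentiable f_smooth It.
case: (split_ordP a) => a' ->; case: (split_ordP b) => b' ->.
- by rewrite !ord1 -/o warpedE00; exact: differentiable_cst.
- by rewrite !ord1 -/o -/(r b') warpedE0r; exact: differentiable_cst.
- by rewrite !ord1 -/o -/(r a') warpedEr0; exact: differentiable_cst.
rewrite -/(r a') -/(r b') warpedErr; apply: differentiableM.
  exact: (differentiableM dc dc).
apply: (@differentiable_comp _ _ _ _ (@rsubmx R 1 1 n) (fun z => gM d z a' b')).
  exact: differentiable_rsubmx.
exact: (smooth_differentiable (riem_smooth rM d a' b') ry).
Qed.

(** The row [o] of the metric is that of the identity, so raising this index is trivial and no
    inverse has to be computed. This symbol carries the second fundamental form of the slices. *)
Lemma chr_warped0 y b e : I (lsubmx y 0 0) -> range_of d (rsubmx y) ->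
  chr W y o (r b) (r e)
    = - (f (y 0 o) * f^`()%classic (y 0 o) * gM d (rsubmx y) b e).
Proof.
move=> It ry.
have := chr_lower (r b) (r e) o (warped_unit It ry) (warped_sym ry).
rewrite big_split_ord big_ord1 /= -/o [X in _ + X]big1 ?addr0 => [|k _]; last first.
  by rewrite -/(r k) [X in _ * X](congr1 (@^~ y) (warpedEr0 k)) mulr0.
rewrite [X in _ * X](congr1 (@^~ y) warpedE00) mulr1 => ->.
rewrite !warpedEr0 partial0_warped; last by move: It; rewrite mxE.
by rewrite /partial !derive_cst; field.
Qed.

(** In the bracket only the t-derivative of the fiber block could survive, and it is proportional to
    f'. *)
Lemma chr_warpedr y a b : I (y 0 o) -> f^`()%classic (y 0 o) = 0 ->
  chr W y (r a) (r b) o = 0.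
Proof.
move=> It f0; rewrite /chr big1 ?mulr0// => k _.
case: (split_ordP k) => k' ->.
  rewrite !ord1 -/o warpedE00 warpedEr0 /partial !derive_cst.
  by rewrite addrK mulr0.
rewrite -/(r k') warpedE0r warpedEr0 partial0_warped// f0 /partial !derive_cst.
by rewrite mulr0 mul0r !addr0 subr0 mulr0.
Qed.

End WarpedMetric.

(** * Hypersurfaces of the warped product *)

Section Forms.
Variable R : realType.

Lemma mulmx_bform n m p (A : 'M[R]_(n, m)) (G : 'M[R]_m) (B : 'M[R]_(p, m)) i j :
  (A *m G *m B^T) i j = bform G (A i) (B j).
Proof.
rewrite mxE /bform exchange_big; apply: eq_bigr => b _; rewrite !mxE mulr_suml.
by apply: eq_bigr.
Qed.

Lemma bformZG m k (G : 'I_m -> 'I_m -> R) v w :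
  bform (fun a b => k * G a b) v w = k * bform G v w.
Proof.
rewrite mulr_sumr; apply: eq_bigr => a _; rewrite mulr_sumr; apply: eq_bigr => b _.
by ring.
Qed.

Lemma bform_shift n (G : 'I_(1 + n) -> 'I_(1 + n) -> R) v w :
  v (lshift n 0) = 0 -> w (lshift n 0) = 0 ->
  bform G v w = bform (fun a b => G (rshift 1 a) (rshift 1 b))
                  (fun a => v (rshift 1 a)) (fun a => w (rshift 1 a)).
Proof.
move=> v0 w0; rewrite /bform big_split_ord big_ord1 /= [X in X + _]big1 ?add0r => [|b _].
  by apply: eq_bigr => a _; rewrite big_split_ord big_ord1 /= w0 mulr0 add0r.
by rewrite v0 !mul0r.
Qed.

Lemma nabla_diffE n m (T T' : topologicalType) (A : atlas R n T) (B : atlas R m T')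
  (g : metric A) (g' : metric B) (u : T -> T') (c : chart A) (d : chart B) x i j a :
  nabla_diff g g' u c d x i j a
  = partial i (fun y => dmap (local_map u c d) j y a) x
    - \sum_(k < n) chr (g c) x k i j * dmap (local_map u c d) k x a
    + \sum_(b < m) \sum_(e < m) chr (g' d) (local_map u c d x) a b e
       * dmap (local_map u c d) i x b * dmap (local_map u c d) j x e.
Proof.
rewrite /nabla_diff; congr (_ - _ + _).
  by apply: eq_bigr => k _; rewrite mxE.
by apply: eq_bigr => b _; apply: eq_bigr => e _; rewrite !mxE.
Qed.

End Forms.

Section Main.
Variables (R : realType) (n : nat).
Hypothesis n_gt0 : (0 < n)%N.
Variables (I : set R) (f : R -> R).
Hypothesis I_open : open I.
Hypothesis f_smooth : smooth_on I f.
Hypothesis f_gt0 : forall t, I t -> 0 < f t.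
Variables (TM : topologicalType) (M : atlas R n TM) (gM : metric M).
Hypothesis rM : is_riemannian gM.
Variables (TS : topologicalType) (S : atlas R n TS) (g : metric S).
Variable phi : TS -> R * TM.

Let N := warped_atlas I M.
Let gN : metric N := warped_metric I f gM.
Let h : TS -> R := fun p => (phi p).1.
Hypothesis rg : is_riemannian g.
Hypothesis imm : isometric_immersion (B := N) g gN phi.

Implicit Types (c : chart S) (d : chart N) (x y : 'rV[R]_n).

Let mS := riem_manifold rg.
Let F c d : 'rV[R]_n -> 'rV[R]_(1 + n) := local_map (B := N) phi c d.
Let U c d := local_dom (B := N) phi c d.
(** The fiber part of [phi] in coordinates, a map between spaces of the same dimension. *)
Let Y c d y : 'rV[R]_n := coords (d : chart M) (phi (param c y)).2.
Let o : 'I_(1 + n) := lshift n 0.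
Let r (b : 'I_n) : 'I_(1 + n) := rshift 1 b.

Lemma immersed_map0 c d y : F c d y 0 o = h (param c y).
Proof. by rewrite /F /local_map /= row_mxEl mxE. Qed.

Lemma immersed_mapr c d y b : F c d y 0 (r b) = Y c d y 0 b.
Proof. by rewrite /F /local_map /= row_mxEr. Qed.

Lemma rsubmx_immersed c d y : rsubmx (F c d y) = Y c d y.
Proof. by rewrite /F /local_map /= row_mxKr. Qed.

Lemma immersed_dom_open c d : open (U c d).
Proof.
apply: (local_dom_open mS); first by case: imm => -[_ + _] _; apply.
rewrite openE => -[t q] [/= It dq]; exists (I, dom (d : chart M)) => //=.
by split; apply: open_nbhs_nbhs; split=> //; exact: (dom_open (riem_manifold rM)).
Qed.

Lemma immersed_base c d y : U c d y -> I (F c d y 0 o).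
Proof. by rewrite immersed_map0 => /(local_domP mS)[_ _ []]. Qed.

Lemma immersed_lsubmx c d y : U c d y -> I (lsubmx (F c d y) 0 0).
Proof. by move=> Uy; rewrite [lsubmx _ _ _]mxE; exact: immersed_base Uy. Qed.

Lemma immersed_fiber c d y : U c d y -> range_of (d : chart M) (rsubmx (F c d y)).
Proof.
by rewrite rsubmx_immersed => /(local_domP mS)[_ _ [_ dy]]; exact: range_coords.
Qed.

Lemma immersed_range c d y : U c d y -> range_of c y.
Proof. by move=> /(local_domP mS)[]. Qed.

Lemma immersed_smooth c d a : smooth_on (U c d) (fun y => F c d y 0 a).
Proof. by case: imm => -[_ _ +] _; apply. Qed.

Lemma immersed_metric c d y j l : U c d y ->
  g c y j l = 1 * bform (gN d (F c d y)) (dmap (F c d) j y) (dmap (F c d) l y).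
Proof.
move=> Uy; have [ry cy dy] := (local_domP mS _ _ _ _).1 Uy.
have [_ /(_ c d _ cy dy)[_]] := imm; rewrite (paramK mS ry) => <-.
rewrite mul1r mulmx_bform; congr (bform _ _ _); apply/funext => a; exact: mxE.
Qed.

Lemma immersed_gauss c d x i j l : U c d x ->
  bform (gN d (F c d x)) (nabla_diff g gN phi c d x i j) (dmap (F c d) l x) = 0.
Proof.
move=> Ux; rewrite -[RHS](@gauss_normal R n (1 + n) (U c d) (F c d) (g c) (gN d) 1
  (@immersed_dom_open c d) (@immersed_smooth c d) _ _ _ _ (oner_neq0 _)
  (@immersed_metric c d) i j l x Ux).
- by congr (bform _ _ _); apply/funext => a; exact: nabla_diffE.
- move=> y a b Uy; apply: warped_differentiable => //; first exact: immersed_base Uy.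
  exact: immersed_fiber Uy.
- by move=> y Uy; apply: warped_unit => //; [exact: immersed_lsubmx | exact: immersed_fiber].
- by move=> y Uy; apply: warped_sym => //; exact: immersed_fiber.
- by move=> y Uy; exact: riem_unit rg _ _ (immersed_range Uy).
Qed.

Lemma tension_normal c d x l : U c d x ->
  bform (gN d (F c d x)) (tension g gN phi c d x 0) (dmap (F c d) l x) = 0.
Proof.
move=> Ux.
have -> : tension g gN phi c d x 0 = fun a => \sum_(i < n) \sum_(j < n)
    invmx (g c x) i j * nabla_diff g gN phi c d x i j a by apply/funext => a; rewrite mxE.
rewrite bform_suml big1// => i _; rewrite bform_suml big1// => j _.
by rewrite bformZl immersed_gauss ?mulr0.
Qed.

(** Pair the equation with the tangent vector dphi(d_l): the left side is normal and gives 0, while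
    the metric lowers the index of the gradient and gives d_l h. *)
Lemma dfun_eq0 c d x : U c d x ->
  tension g gN phi c d x = gradient g h c x *m tangent_map phi c d x ->
  dfun h c x = 0.
Proof.
move=> Ux tE; apply/rowP => l; rewrite [RHS]mxE -(tension_normal l Ux) tE.
have -> : (gradient g h c x *m tangent_map (B := N) phi c d x) 0
   = fun a => \sum_(k < n) gradient g h c x 0 k * dmap (F c d) k x a.
  by apply/funext => a; rewrite mxE; apply: eq_bigr => k _; congr (_ * _); exact: mxE.
rewrite bform_suml; transitivity ((gradient g h c x *m g c x) 0 l).
  by rewrite mulmxKV// (riem_unit rg (immersed_range Ux)).
by rewrite mxE; apply: eq_bigr => k _; rewrite bformZl (immersed_metric k l Ux) mul1r.
Qed.

(** * Immersions contained in a slice {t0} x M *)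

Section Slice.
Variable t0 : R.
Hypothesis ht0 : forall p, carrier S p -> h p = t0.

Lemma dmap0 c d j y : U c d y -> dmap (F c d) j y o = 0.
Proof.
move=> Uy; rewrite /dmap /partial (@near_eq_derive _ _ _ _ (cst t0)) ?derive_cst//.
have : nbhs y (U c d) by apply: open_nbhs_nbhs; split => //; exact: immersed_dom_open.
apply: filterS => z /(local_domP mS)[_ cz _]; rewrite immersed_map0 /cst.
by apply: ht0; exists c.
Qed.

Lemma dmapr c d j b : (fun y => dmap (F c d) j y (r b)) = (fun y => dmap (Y c d) j y b).
Proof.
apply/funext => y; rewrite /dmap; congr (partial _ _ _); apply/funext => z.
exact: immersed_mapr.
Qed.

Lemma slice_base c d y : U c d y -> F c d y 0 o = t0.
Proof. by move=> /(local_domP mS)[_ cy _]; rewrite immersed_map0 ht0//; exists c. Qed.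

Lemma slice_I c d y : U c d y -> I t0.
Proof. by move=> Uy; have := immersed_base Uy; rewrite slice_base. Qed.

Lemma slice_metric c d y j l : U c d y ->
  g c y j l = f t0 ^+ 2 * bform (gM d (Y c d y)) (dmap (Y c d) j y) (dmap (Y c d) l y).
Proof.
move=> Uy; rewrite (immersed_metric _ _ Uy) mul1r bform_shift ?dmap0//.
rewrite -bformZG; congr (bform _ _ _).
- apply/funext => a; apply/funext => b; rewrite /gN.
  rewrite [LHS](congr1 (@^~ (F c d y)) (@warpedErr R n I f TM M gM d a b)).
  by rewrite -/o slice_base// rsubmx_immersed expr2.
- by apply/funext => a; exact: (congr1 (@^~ y) (dmapr c d j a)).
- by apply/funext => a; exact: (congr1 (@^~ y) (dmapr c d l a)).
Qed.

Let K c d y : 'M[R]_n := \matrix_(j, b) dmap (Y c d) j y b.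

Lemma slice_metricE c d y : U c d y ->
  g c y = f t0 ^+ 2 *: (K c d y *m gM d (Y c d y) *m (K c d y)^T).
Proof.
move=> Uy; apply/matrixP => j l; rewrite mxE mulmx_bform (slice_metric j l Uy).
by congr (_ * bform _ _ _); apply/funext => a; rewrite mxE.
Qed.

(** Square factors of the invertible matrix [g c y] are themselves invertible; in particular the
    fiber part of [phi] is a local diffeomorphism. *)
Lemma slice_unit c d y : U c d y ->
  K c d y \in unitmx /\ gM d (Y c d y) \in unitmx.
Proof.
move=> Uy; have := riem_unit rg (immersed_range Uy); rewrite (slice_metricE Uy).
rewrite unitmxZ; last by rewrite unitfE expf_neq0// gt_eqF// (f_gt0 (slice_I Uy)).
by rewrite !unitmx_mul => /andP[/andP[-> ->] _].
Qed.

Lemma slice_smooth c d b : smooth_on (U c d) (fun y => Y c d y 0 b).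
Proof.
have := @immersed_smooth c d (r b).
by under [X in smooth_on _ X -> _]eq_fun do rewrite immersed_mapr.
Qed.

Lemma slice_fiber c d y : U c d y -> range_of (d : chart M) (Y c d y).
Proof. by move=> Uy; rewrite -rsubmx_immersed; exact: immersed_fiber. Qed.

(** The Gauss formula with [s] equal to f(t0)^2 makes the second covariant derivative of [Y]
    orthogonal to every dY(d_l). These span, because [K] is invertible, so nothing normal is left
    and it vanishes. *)
Lemma slice_affine c d y i j a : U c d y ->
  partial i (fun z => dmap (Y c d) j z a) y
    = \sum_(k < n) chr (g c) y k i j * dmap (Y c d) k y a
      - cform (chr (gM d)) (Y c d y) (dmap (Y c d) i y) (dmap (Y c d) j y) a.
Proof.
move=> Uy; have [Ku Gu] := slice_unit Uy.
pose v : 'rV[R]_n := \row_a (partial i (fun z => dmap (Y c d) j z a) y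
    - \sum_(k < n) chr (g c) y k i j * dmap (Y c d) k y a
    + cform (chr (gM d)) (Y c d y) (dmap (Y c d) i y) (dmap (Y c d) j y) a).
have v0 : v *m gM d (Y c d y) *m (K c d y)^T = 0.
  apply/rowP => l; rewrite mulmx_bform [RHS]mxE.
  rewrite -[RHS](@gauss_normal R n n (U c d) (Y c d) (g c) (gM d) (f t0 ^+ 2)
    (@immersed_dom_open c d) (@slice_smooth c d) _ _ _ _ _
    (@slice_metric c d) i j l y Uy).
  - by congr (bform _ _ _); apply/funext => b; rewrite mxE.
  - by move=> z b e Uz; exact: smooth_differentiable (riem_smooth rM d b e) (slice_fiber Uz).
  - by move=> z Uz; have [] := slice_unit Uz.
  - by move=> z Uz; exact: riem_sym rM _ _ (slice_fiber Uz).
  - by move=> z Uz; exact: riem_unit rg _ _ (immersed_range Uz).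
  - by rewrite expf_neq0// gt_eqF// (f_gt0 (slice_I Uy)).
have {}v0 : v = 0.
  have KTu : (K c d y)^T \in unitmx by rewrite unitmx_tr.
  by rewrite -[v](mulmxK Gu) -[X in X *m _](mulmxK KTu) v0 !mul0mx.
have /rowP/(_ a) := v0; rewrite !mxE => /eqP.
by rewrite addr_eq0 subr_eq => /eqP ->; rewrite addrC.
Qed.

Lemma slice_ricci c d x : U c d x ->
  ricci g c x = K c d x *m ricci gM d (Y c d x) *m (K c d x)^T.
Proof.
move=> Ux; have [Ku _] := slice_unit Ux; apply/matrixP => j k.
rewrite mulmx_bform mxE.
rewrite [LHS](@ric_natural R n (chr (g c)) (chr (gM d)) (K c d x) x (Y c d x) Ku); last first.
  move=> i j' k' a.
  have := @curv_natural R n n (U c d) (Y c d) (chr (g c)) (chr (gM d))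
    (@immersed_dom_open c d) (@slice_smooth c d) _ _ (@slice_affine c d) i j' k' a x Ux.
  rewrite (eq_bigr (fun l => curv (chr (g c)) x i j' k' l * K c d x l a)) => [->|l _]; last by rewrite mxE.
  - apply: eq_bigr => b _; apply: eq_bigr => e _; apply: eq_bigr => l _; rewrite !mxE.
    by [].
  - by move=> y l p q Uy; exact: christoffel_differentiable rg _ _ _ _ _ (immersed_range Uy).
  - by move=> y l p q Uy; exact: christoffel_differentiable rM _ _ _ _ _ (slice_fiber Uy).
apply: eq_bigr => b _; apply: eq_bigr => e _; congr (_ * _ * _).
by rewrite [RHS]mxE.
Qed.

Lemma slice_f1 c d x : U c d x -> tension g gN phi c d x = 0 ->
  f^`()%classic t0 = 0.
Proof.
move=> Ux tau0; have It := slice_I Ux; have ft := f_gt0 It.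
(* The t-component of [phi] is constant, so only the fiber-fiber symbols with upper index t
   contribute; the f f' in them becomes f'/f when the fiber metric is expressed through [g]. *)
have nab0 i j : nabla_diff g gN phi c d x i j o
    = - (f^`()%classic t0 / f t0) * g c x i j.
  rewrite nabla_diffE -/(F c d) [X in X - _](_ : _ = 0); last first.
    rewrite /partial (@near_eq_derive _ _ _ _ (cst 0)) ?derive_cst//.
    have : nbhs x (U c d) by apply: open_nbhs_nbhs; split => //; exact: immersed_dom_open.
    by apply: filterS => z; exact: dmap0.
  rewrite [X in _ - X]big1 ?subr0 ?add0r => [|k _]; last by rewrite dmap0// mulr0.
  rewrite big_split_ord big_ord1 /= [X in X + _]big1 ?add0r => [|e _]; last first.
    by rewrite dmap0// mulr0 mul0r.
  transitivity (\sum_(b < n) \sum_(e < n) - (f t0 * f^`()%classic t0)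
      * (dmap (Y c d) i x b * gM d (Y c d x) b e * dmap (Y c d) j x e)).
    apply: eq_bigr => b _; rewrite big_split_ord big_ord1 /= dmap0// mulr0 add0r.
    apply: eq_bigr => e _.
    rewrite (chr_warped0 f_smooth f_gt0 rM b e (immersed_lsubmx Ux) (immersed_fiber Ux)).
    rewrite -/o slice_base// rsubmx_immersed.
    rewrite [X in _ * X * _](congr1 (@^~ x) (dmapr c d i b)).
    rewrite [X in _ * X](congr1 (@^~ x) (dmapr c d j e)).
    by ring.
  under eq_bigr do rewrite -mulr_sumr; rewrite -mulr_sumr (slice_metric i j Ux).
  rewrite -/(bform _ _ _); move: (bform _ _ _) => B.
  by field; rewrite gt_eqF.
have : tension g gN phi c d x 0 o = 0 by rewrite tau0 mxE.
rewrite mxE.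
under eq_bigr do under eq_bigr do rewrite nab0 mulrCA.
under eq_bigr do rewrite -mulr_sumr; rewrite -mulr_sumr.
have -> : \sum_(i < n) \sum_(j < n) invmx (g c x) i j * g c x i j = n%:R.
  rewrite -(mxtrace1 R n) -(mulVmx (riem_unit rg (immersed_range Ux))).
  apply: eq_bigr => i _; rewrite mxE; apply: eq_bigr => j _.
  by congr (_ * _); rewrite -[in LHS](riem_sym rg (immersed_range Ux)) mxE.
move/eqP; rewrite mulf_eq0 pnatr_eq0 (negbTE (lt0n_neq0 n_gt0)) orbF oppr_eq0 mulf_eq0 invr_eq0.
by rewrite (gt_eqF ft) orbF => /eqP.
Qed.

(** A normal to the slice has no fiber component, so the fiber part of its derivative involves only
    symbols proportional to f'(t0). The t-component of the derivative is orthogonal to the image of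
    dphi and does not enter the shape operator. *)
Lemma slice_totally_geodesic : f^`()%classic t0 = 0 ->
  totally_geodesic (B := N) g gN phi.
Proof.
move=> f1 c d V nu x oV VU [snu nuE] Vx.
have Ux := VU _ Vx.
have JE y : U c d y -> tangent_map phi c d y = row_mx 0 (K c d y).
  move=> Uy; apply/matrixP => i a; rewrite [LHS]mxE.
  case: (split_ordP a) => a' ->.
    by rewrite row_mxEl [RHS]mxE ord1; exact: dmap0.
  by rewrite row_mxEr [RHS]mxE; exact: (congr1 (@^~ y) (dmapr c d i a')).
have GE y : U c d y -> gN d (F c d y) = block_mx 1%:M 0 0 (f t0 ^+ 2 *: gM d (Y c d y)).
  by move=> Uy; rewrite /gN /warped_metric rsubmx_immersed mxE -/o slice_base.
have nu0 y a : V y -> nu y 0 (r a) = 0.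
  move=> Vy; have Uy := VU _ Vy; have [+ _] := nuE y Vy.
  have [Ku Gu] := slice_unit Uy.
  rewrite -/(F c d) (GE _ Uy) (JE _ Uy) -[nu y]hsubmxK tr_row_mx mul_row_block mul_row_col.
  rewrite !mulmx0 !mul0mx !addr0 !add0r mul0mx add0r -scalemxAr -scalemxAl => /eqP.
  rewrite scaler_eq0 expf_eq0 /= gt_eqF ?(f_gt0 (slice_I Uy))//= => /eqP E.
  have : (rsubmx (nu y))^T = 0.
    by rewrite -[LHS](mulKmx Gu) -[X in _ *m X](mulKmx Ku) [X in _ *m (_ *m X)]mulmxA E !mulmx0.
  by rewrite hsubmxK => /colP/(_ a); rewrite !mxE.
have nn0 i a : nabla_normal gN phi c d nu x i (r a) = 0.
  rewrite mxE [X in X + _](_ : _ = 0); last first.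
    rewrite /partial (@near_eq_derive _ _ _ _ (cst 0)) ?derive_cst//.
    have : nbhs x V by exact: open_nbhs_nbhs.
    by apply: filterS => z; exact: nu0.
  rewrite add0r big1// => b _; rewrite big_split_ord big_ord1 /= [X in _ + X]big1 ?addr0; last first.
    by move=> e _; rewrite nu0// mulr0.
  case: (split_ordP b) => b' ->.
    by rewrite ord1 (JE _ Ux) row_mxEl mxE mulr0 mul0r.
  rewrite [X in X * _ * _](_ : _ = 0) ?mul0r//.
  by apply: (chr_warpedr f_smooth); rewrite -/(F c d) -/o slice_base//; exact: slice_I Ux.
rewrite /shape_operator -/(F c d) (GE _ Ux) (JE _ Ux).
have -> : nabla_normal gN phi c d nu x = row_mx (lsubmx (nabla_normal gN phi c d nu x)) 0.
  apply/matrixP => i a; case: (split_ordP a) => a' ->.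
    by rewrite row_mxEl [RHS]mxE.
  by rewrite row_mxEr [RHS]mxE; exact: nn0.
rewrite tr_row_mx mul_row_block mul_row_col trmx0.
by rewrite !(mulmx0, mul0mx, addr0, oppr0).
Qed.

(** The Ricci bound on M is applied to the image of [w] under dY; dividing by the homothety factor
    f(t0)^2 changes f f'' into f''/f. *)
Lemma slice_ricci_le c d p (w : 'rV[R]_n) : dom c p -> dom d (phi p) -> w != 0 ->
  sectional_le gM (- (f t0 * f^`(2)%classic t0))%:E ->
  qf (ricci g c (coords c p)) w
    <= - (n%:R - 1) * (f^`(2)%classic t0 / f t0) * qf (g c (coords c p)) w.
Proof.
move=> cp dp w0 secM; set x := coords c p.
have Ux : U c d x by exists p.
have [Ku _] := slice_unit Ux.
have ft := f_gt0 (slice_I Ux).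
pose w' := w *m K c d x.
have w'0 : w' != 0.
  by apply: contra_neq w0 => w'0; rewrite -[w](mulmxK Ku) -/w' w'0 mul0mx.
have qfE B : qf (K c d x *m B *m (K c d x)^T) w = qf B w'.
  by rewrite /qf /w' trmx_mul !mulmxA.
have rY := slice_fiber Ux; have [q dq qE] := rY.
rewrite (slice_ricci Ux) qfE (slice_metricE Ux) qfZ qfE.
apply: le_trans (ricci_le (riem_sym rM rY) (riem_posdef rM rY) dq (esym qE) secM w'0) _.
rewrite le_eqVlt; apply/orP; left; apply/eqP.
by field; rewrite gt_eqF.
Qed.

End Slice.
End Main.

(** * Comparison of the structure equation with the curvature bound *)

Theorem theorem4p18 (R : realType) (n : nat) (n_gt0 : (0 < n)%N)
    (I : set R) (I_neq0 : I !=set0) (I_open : open I) (I_itv : is_interval I)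
    (f : R -> R) (f_smooth : smooth_on I f) (f_gt0 : forall t, I t -> 0 < f t)
    (TM : topologicalType) (M : atlas R n TM) (gM : metric M)
    (M_riemannian : is_riemannian gM) (M_connected : connected_manifold M)
    (oM : chart M -> TM -> bool) (M_oriented : is_orientation oM)
    (M_sectional : sectional_le gM
       (ereal_inf [set ((f^`()%classic t) ^+ 2 - f t * f^`(2)%classic t)%:E | t in I]))
    (TS : topologicalType) (S : atlas R n TS) (g : metric S)
    (phi : TS -> R * TM) (alpha : R) (mu lam : TS -> R) :
  let N := warped_atlas I M in
  let gN : metric N := warped_metric I f gM in
  let h : TS -> R := fun p => (phi p).1 in
  isometric_immersion (B := N) g gN phi ->
  gradient_einstein_type (B := N) g gN phi alpha h mu lam ->
  ~ (forall p, carrier S p ->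
       - (n%:R - 1) * (f^`(2)%classic (h p) / f (h p)) <= lam p)
  /\
  ((forall (c : chart S) (d : chart N) p, dom c p -> dom d (phi p) ->
      - (n%:R - 1) * (f^`(2)%classic (h p) / f (h p))
        - alpha / n%:R * energy g gN phi c d (coords c p) <= lam p) ->
   [/\ einstein_harmonic S h,
     totally_geodesic (B := N) g gN phi &
     forall (c : chart S) (d : chart N) p, dom c p -> dom d (phi p) ->
       alpha * energy g gN phi c d (coords c p)
         = n%:R * (- (n%:R - 1) * (f^`(2)%classic (h p) / f (h p)) - lam p)]).
Proof.
move=> N gN h imm [rg conS _ [alpha0 [phiN _ _]] [sh _ _ eqs]].
have mS := riem_manifold rg.
have [[p0 [c0 cp0]] _] := conS.
have inU (c : chart S) (d : chart N) p : dom c p -> dom d (phi p) -> local_dom (B := N) phi c d (coords c p).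
  by move=> cp dp; exists p.
have dfun0 (c : chart S) p : dom c p -> dfun h c (coords c p) = 0.
  move=> cp; have [d dp] : carrier N (phi p) by apply: phiN; exists c.
  have [_ tE] := eqs c d p cp dp.
  exact: (dfun_eq0 I_open f_smooth f_gt0 M_riemannian rg imm (inU _ _ _ cp dp) tE).
have [t0 ht0] : einstein_harmonic S h by exact: const_of_dfun0 mS _ sh conS dfun0.
have hess0 (c : chart S) p : dom c p -> hess g h c (coords c p) = 0.
  move=> cp; have d0 k y : range_of c y -> partial k (h \o param c) y = 0.
    move=> ry; have /rowP/(_ k) := dfun0 c _ (dom_param mS ry).
    by rewrite (paramK mS ry) !mxE.
  have rp := range_coords cp.
  apply/matrixP => i j; rewrite !mxE big1 ?subr0 => [|k _]; last by rewrite d0// mulr0.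
  rewrite /partial (@near_eq_derive _ _ _ _ (cst 0)) ?derive_cst//.
  have : nbhs (coords c p) (range_of c) by apply: open_nbhs_nbhs; split=> //; exact: range_open.
  by apply: filterS => y; exact: d0.
have [d0 dp0] : carrier N (phi p0) by apply: phiN; exists c0.
have U0 := inU _ _ _ cp0 dp0.
have It := slice_I rg ht0 U0.
have f1 : f^`()%classic t0 = 0.
  have [_ tE] := eqs c0 d0 p0 cp0 dp0.
  apply: (slice_f1 n_gt0 I_open f_smooth f_gt0 M_riemannian rg imm ht0 U0).
  by rewrite tE /gradient dfun0// !mul0mx.
(* An infimum is at most the value at [t0], where the square of f' is 0. *)
have secM : sectional_le gM (- (f t0 * f^`(2)%classic t0))%:E.
  move=> d q v w dq vw; apply: le_trans (M_sectional d q v w dq vw) _.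
  by apply: ereal_inf_lbound; exists t0 => //; rewrite f1 expr0n sub0r.
have pullE (c : chart S) (d : chart N) p : dom c p -> dom d (phi p) ->
    pullback (B := N) gN phi c d (coords c p) = g c (coords c p).
  by move=> cp dp; have [_ /(_ c d p cp dp)[]] := imm.
have enE (c : chart S) (d : chart N) p : dom c p -> dom d (phi p) -> energy g gN phi c d (coords c p) = n%:R.
  by move=> cp dp; rewrite /energy pullE// mulVmx ?mxtrace1// (riem_unit rg (range_coords cp)).
have lamE (c : chart S) (d : chart N) p : dom c p -> dom d (phi p) ->
    lam p + alpha <= - (n%:R - 1) * (f^`(2)%classic (h p) / f (h p)).
  move=> cp dp; have [ricE _] := eqs c d p cp dp.
  have hp : h p = t0 by apply: ht0; exists c.
  (* Both sides of the comparison are multiples of [g], so a single nonzero vector decides it;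
     positivity of [n] provides one. *)
  pose w : 'rV[R]_n := delta_mx 0 (Ordinal n_gt0).
  have w0 : w != 0 by apply/eqP => /rowP/(_ (Ordinal n_gt0))/eqP; rewrite !mxE !eqxx oner_eq0.
  have := slice_ricci_le I_open f_gt0 M_riemannian rg imm ht0 cp dp w0 secM.
  rewrite (_ : ricci g c (coords c p) = (lam p + alpha) *: g c (coords c p)); last first.
    move: ricE; rewrite pullE// hess0// dfun0// mulmx0 scaler0 addr0 subr0 => /eqP.
    by rewrite subr_eq -scalerDl => /eqP.
  by rewrite qfZ hp ler_pM2r//; exact: (riem_posdef rg (range_coords cp)).
split=> [lamB|lamB].
  (* At [p0] the assumption gives lambda >= lambda + alpha, against alpha > 0. *)
  have := lamE _ _ _ cp0 dp0; have := lamB p0 (ex_intro _ c0 cp0); lra.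
split; first by exists t0.
  exact: (slice_totally_geodesic I_open f_smooth f_gt0 M_riemannian rg imm ht0 f1).
move=> c d p cp dp; have := lamE _ _ _ cp dp; have := lamB _ _ _ cp dp.
(* With energy [n] the assumption bounds lambda + alpha from below by the same quantity that bounds
   it from above, so equality holds. *)
rewrite enE// divfK ?pnatr_eq0 ?lt0n_neq0// => l1 l2.
by rewrite mulrC; congr (_ * _); apply/eqP; rewrite eq_le; apply/andP; split; lra.
Qed.
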